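(* Let $q\in\mathbb{Q}\setminus\tfrac{1}{2}\mathbb{Z}$. Then at least one of the sequences $\left\{\Gamma^{(n)}(q)\right\}_{n\geq 1}$, $\left\{\Gamma^{(n)}(1-q)\right\}_{n\geq 1}$ contains infinitely many transcendental elements; that is, either there are infinitely many integers $n\geq 1$ such that $\Gamma^{(n)}(q)$ is transcendental, or there are infinitely many integers $n\geq 1$ such that $\Gamma^{(n)}(1-q)$ is transcendental (or both).
   Context: $\Gamma$ denotes the Euler Gamma function (meromorphically continued, so that it is analytic at every real point outside $\mathbb{Z}_{\leq 0}=\{0,-1,-2,\ldots\}$), and $\Gamma^{(n)}(x)$ denotes its $n$-th derivative evaluated at $x$. The set $\tfrac{1}{2}\mathbb{Z}=\{k/2: k\in\mathbb{Z}\}$. A number is transcendental if it is not algebraic over $\mathbb{Q}$. Elements of a sequence are counted by index. *)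

(* Defs.v *)
From mathcomp Require Import all_boot all_order all_algebra.
From mathcomp Require Import all_classical all_reals all_analysis.

Set Implicit Arguments.
Unset Strict Implicit.
Unset Printing Implicit Defensive.

Import Order.TTheory GRing.Theory Num.Theory.
Import numFieldNormedType.Exports.

Local Open Scope classical_set_scope.
Local Open Scope ring_scope.

(* Meaningful only for 0 < x, where the integrand is integrable. *)
Definition euler_integral (R : realType) (x : R) : R :=
  Rintegral lebesgue_measure `]0, +oo[ (fun t : R => t `^ (x - 1) * expR (- t)).

(* The meromorphic continuation, restricted to the real line: with n the least
   natural number such that 0 < x + n (so n = 0 when 0 < x),
     Gamma x = Gamma (x + n) / (x (x + 1) ... (x + n - 1)).
   At the poles 0, -1, -2, ... the denominator vanishes and the value is 0.
   As the continuation is analytic at, and real on, the real points that are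
   not poles, its complex derivatives at such points are the iterated real
   derivatives of this function. *)
Definition Gamma (R : realType) (x : R) : R :=
  let n := Num.truncn (1 - x) in
  euler_integral (x + n%:R) / \prod_(i < n) (x + i%:R).

Definition transcendental (R : realType) (x : R) : Prop :=
  ~ algebraicOver (ratr : rat -> R) x.

(* Main.v *)
Require Import Defs.
From HB Require Import structures.
From mathcomp Require Import all_boot all_order all_algebra.
From mathcomp Require Import all_classical all_reals all_analysis.
From mathcomp Require Import perm measurable_realfun.
From mathcomp Require Import -(notations) mpoly.
From mathcomp Require Import complex.
From mathcomp Require Import ring lra zify.

Import Order.TTheory GRing.Theory Num.Theory.
Import numFieldNormedType.Exports.

Set Implicit Arguments.
Unset Strict Implicit.
Unset Printing Implicit Defensive.

Local Open Scope classical_set_scope.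
Local Open Scope ring_scope.

(** The reflection formula says that Gamma(x) * Gamma(1 - x) = pi / sin(pi x).
    Put a_n = Gamma^(n)(q) and b_n = Gamma^(n)(1 - q).  Differentiating the
    formula n times at q by Leibniz' rule gives
      sum_k binom(n, k) (-1)^(n - k) a_k b_(n - k) = c_n pi^(n + 1),
    where c_n is (-1)^n P_n(cos (pi q)) / sin(pi q)^(n + 1) for a polynomial P_n
    with rational coefficients.  Since q is rational, c_n is algebraic; since
    2q is not an integer, cos (pi q) is nonzero, and then so is c_n
    [cscpoly_neq0].

    Suppose a_n and b_n are algebraic for all n >= N.  When n >= 2N, each
    product a_k b_(n - k) has an algebraic factor, so the left-hand side lies in
    the vector space over the real algebraic numbers spanned by 1 and the a_k and
    b_k with k < N.  All large powers of pi then lie in one finite-dimensional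
    space, so they are linearly dependent over the algebraic numbers
    [algebraic_of_span], and pi is algebraic: a contradiction.

    Transcendence of pi [pi_transcendental] is proved by Lindemann's method.  If
    pi were algebraic, let cs list the roots of a rational polynomial that
    vanishes at i pi, scaled by an integer a to become algebraic integers.  Expanding the product of the 1 + e^(c / a),
    which is 0, gives a vanishing sum of e^(s / a) over all subset sums s of cs.
    Hermite's operator applied to x^(p - 1) T(x)^p, with T an integral polynomial
    having the nonzero subset sums as roots, turns it into a multiple of (p - 1)!
    that is nonzero for a large prime p [shermite_aux], yet grows only
    geometrically in p [hermite_bound].  Symmetric function theory makes the sums
    over all subsets integers.

    The reflection formula [Gamma_reflection] comes from Gauss' limit, here in
    the form of the two-sided bound [gauss_ratio_bound], which follows from
    integrating a tangent-line inequality, and from Euler's sine product with a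
    remainder [sine_product].  The remainder is a quotient of integrals of
    cos(yt) cos(t)^n over [0, pi/2], which satisfy a two-term recurrence. *)

(** * Symmetric functions of the roots of an integral polynomial *)

Lemma poly_int_lift (C : nzRingType) (p : {poly C}) :
  (forall k, exists z : int, p`_k = z%:~R) -> exists P : {poly int}, map_poly intr P = p.
Proof.
move=> /choice[z hz]; exists (\poly_(i < size p) z i).
apply/polyP => i; rewrite coef_map coef_poly.
by case: ltnP => hi /=; [rewrite -hz | rewrite nth_default].
Qed.

Section Symmetric.
Variables (C : idomainType) (d : nat) (cs : d.-tuple C) (P : {poly int}).
Hypothesis hP : map_poly intr P = \prod_(c <- cs) ('X - c%:P).

Let ev : mpoly d int -> C := mmap intr (tnth cs).

Lemma mesym_root_int k : exists z : int, ev (mesym d int k) = z%:~R.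
Proof.
have [kd|dk] := leqP k d; last first.
  by exists 0; rewrite /ev mesym_geqnE // raddf0 mulr0z.
exists ((-1) ^+ k * P`_(d - k)).
have := mroots_coeff (R := C) cs (inord k); rewrite -hP inordK // coef_map /=.
rewrite rmorphM rmorphXn rmorphN rmorph1 /= => ->.
rewrite mulrA -expr2 sqrr_sign mul1r.
rewrite /ev /mesym !raddf_sum /=; apply/eq_bigr => i _.
by rewrite !rmorph_prod /=; apply/eq_bigr => j _; rewrite mmapX mmap1U mevalXU.
Qed.

(** A symmetric polynomial is a polynomial in the elementary ones, whose values
    are the coefficients of P up to sign. *)
Lemma sym_root_int f : f \is symmetric -> exists z : int, ev f = z%:~R.
Proof.
move=> /sym_fundamental[t [<- _]].
have /choice[e he] : forall i : 'I_d, exists z : int, ev (mesym d int i.+1) = z%:~R.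
  by move=> i; exact: mesym_root_int.
exists (meval e t).
rewrite comp_mpolyE mevalE /ev [LHS]raddf_sum rmorph_sum /=.
apply: eq_bigr => m _; rewrite mmapZ rmorphM rmorph_prod rmorph_prod /=.
congr (_ * _); apply: eq_bigr => i _; rewrite !rmorphXn /= -he.
by rewrite tnth_mktuple.
Qed.

Definition subsum (S : {set 'I_d}) : C := \sum_(i in S) tnth cs i.

Let msubsum (S : {set 'I_d}) : mpoly d int := \sum_(i in S) mpolyX int (mnm1 i).

Let ev_msubsum S : ev (msubsum S) = subsum S.
Proof.
rewrite /ev /msubsum raddf_sum; apply: eq_bigr => i _.
by rewrite /= mmapX mmap1U.
Qed.

Let msym_msubsum s S : msym s (msubsum S) = msubsum (s @: S).
Proof.
rewrite /msubsum raddf_sum big_imset /=; last by move=> ? ? _ _; exact: perm_inj.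
apply: eq_bigr => i _; rewrite msymX; congr mpolyX.
by apply/mnmP => j; rewrite mnmE !mnm1E; congr (nat_of_bool _); apply/eqP/eqP=> [->|<-]; rewrite ?permKV ?permK.
Qed.

Let imset_perm_inj (s : {perm 'I_d}) : injective (fun S : {set 'I_d} => s @: S).
Proof. exact/imset_inj/perm_inj. Qed.

(** Permuting the variables permutes the subset sums, so the sum over all
    subsets is a symmetric polynomial in the roots. *)
Lemma subsum_horner_int (H : {poly int}) :
  exists z : int, \sum_S (map_poly intr H).[subsum S] = z%:~R.
Proof.
pose f := \sum_S (map_poly (@mpolyC d int) H).[msubsum S].
have fsym : f \is symmetric.
  apply/issymP => s; rewrite /f raddf_sum /=.
  rewrite [RHS](reindex_inj (@imset_perm_inj s)) /=; apply: eq_bigr => S _.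
  rewrite -horner_map /= msym_msubsum -map_poly_comp; congr (_.[_]).
  by apply: eq_map_poly => x; rewrite /= -alg_mpolyC msymZ msym1.
have [z hz] := sym_root_int fsym; exists z; rewrite -hz /ev /f raddf_sum /=.
apply: eq_bigr => S _; rewrite -horner_map /= -ev_msubsum -map_poly_comp.
by congr (_.[_]); apply: eq_map_poly => x; rewrite /= mmapC.
Qed.

Lemma subsum_poly_int :
  exists Q : {poly int}, map_poly intr Q = \prod_S ('X - (subsum S)%:P).
Proof.
apply: poly_int_lift => k.
pose g := \prod_S ('X - (msubsum S)%:P).
have gsym : g`_k \is symmetric.
  apply/issymP => s; rewrite -coef_map; congr ((polyseq _)`_k).
  rewrite /g rmorph_prod /= [RHS](reindex_inj (@imset_perm_inj s)) /=.
  by apply: eq_bigr => S _; rewrite rmorphB /= map_polyX map_polyC /= msym_msubsum.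
have [z hz] := sym_root_int gsym; exists z; rewrite -hz /ev -coef_map; congr ((polyseq _)`_k).
rewrite rmorph_prod; apply: eq_bigr => S _.
by rewrite rmorphB /= map_polyX map_polyC /= -ev_msubsum.
Qed.

End Symmetric.

(** * The complex exponential and Hermite's estimate *)

Local Notation Re := complex.Re.
Local Notation Im := complex.Im.

Section ComplexExp.
Context {R : realType}.
Local Notation C := R[i].
Implicit Types (z w : C) (t : R).

Definition cexp z : C := Complex (expR (Re z) * cos (Im z)) (expR (Re z) * sin (Im z)).

Lemma cexpD z w : cexp (z + w) = cexp z * cexp w.
Proof.
case: z w => [a b] [c d]; rewrite /cexp /= expRD cosD sinD.
by congr Complex => /=; ring.
Qed.

Lemma cexp0 : cexp 0 = 1.
Proof. by rewrite /cexp /= expR0 cos0 sin0 mul1r mul1r. Qed.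

Lemma cexp_sum (I : Type) (r : seq I) (Q : pred I) (f : I -> C) :
  cexp (\sum_(i <- r | Q i) f i) = \prod_(i <- r | Q i) cexp (f i).
Proof. exact: (big_morph cexp cexpD cexp0). Qed.

Lemma cexp_pi : cexp (Complex 0 pi) = -1.
Proof. by rewrite /cexp /= expR0 cospi sinpi mul1r mulr0; apply/eqP; rewrite eq_complex /= oppr0 !eqxx. Qed.

Lemma norm_cexp z : `|cexp z| = (expR (Re z))%:C%C.
Proof.
rewrite normc_def /cexp /=; congr (real_complex_def _ _).
have -> : (expR (Re z) * cos (Im z)) ^+ 2 + (expR (Re z) * sin (Im z)) ^+ 2 = expR (Re z) ^+ 2.
  by rewrite !exprMn -mulrDr cos2Dsin2 mulr1.
by rewrite sqrtr_sqr ger0_norm // expR_ge0.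
Qed.

Lemma Re_le_norm z : (`|Re z|)%:C%C <= `|z|.
Proof. exact: normc_ge_Re. Qed.

Lemma Im_le_norm z : (`|Im z|)%:C%C <= `|z|.
Proof.
rewrite normc_def lecR -sqrtr_sqr.
by rewrite ler_wsqrtr // lerDr sqr_ge0.
Qed.

Lemma norm_le_ReIm z : `|z| <= (`|Re z| + `|Im z|)%:C%C.
Proof.
rewrite rmorphD /= {1}[z]complexE (le_trans (ler_normD _ _)) //.
rewrite normrM !normc_def /= !expr0n /= !addr0 ?add0r expr1n sqrtr1 !sqrtr_sqr mul1r.
by rewrite lexx.
Qed.

Lemma ReD z w : Re (z + w) = Re z + Re w.
Proof. by case: z w => [? ?] [? ?]. Qed.

Lemma ImD z w : Im (z + w) = Im z + Im w.
Proof. by case: z w => [? ?] [? ?]. Qed.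

Lemma ReB z w : Re (z - w) = Re z - Re w.
Proof. by case: z w => [? ?] [? ?]. Qed.

Lemma ImB z w : Im (z - w) = Im z - Im w.
Proof. by case: z w => [? ?] [? ?]. Qed.

Lemma ReM z w : Re (z * w) = Re z * Re w - Im z * Im w.
Proof. by case: z w => [? ?] [? ?]. Qed.

Lemma ImM z w : Im (z * w) = Re z * Im w + Im z * Re w.
Proof. by case: z w => [? ?] [? ?]. Qed.

(** Differentiability of a complex function of a real variable is read on its two
    real components, so that the real mean value theorem applies to each. *)
Definition cderiv (g : R -> C) t (dg : C) :=
  is_derive t 1 (fun s => Re (g s)) (Re dg) /\ is_derive t 1 (fun s => Im (g s)) (Im dg).

Lemma cderiv_cst w t : cderiv (fun=> w) t 0.
Proof. by split; apply: is_derive_cst. Qed.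

Lemma cderivD f g t df dg :
  cderiv f t df -> cderiv g t dg -> cderiv (fun s => f s + g s) t (df + dg).
Proof.
move=> [f1 f2] [g1 g2]; split.
  by rewrite ReD; under eq_fun do rewrite ReD; exact: is_deriveD.
by rewrite ImD; under eq_fun do rewrite ImD; exact: is_deriveD.
Qed.

Lemma cderivM f g t df dg : cderiv f t df -> cderiv g t dg ->
  cderiv (fun s => f s * g s) t (df * g t + f t * dg).
Proof.
move=> [f1 f2] [g1 g2]; split.
  under eq_fun do rewrite ReM.
  by apply: is_derive_eq; rewrite ReD !ReM /GRing.scale /=; ring.
under eq_fun do rewrite ImM.
by apply: is_derive_eq; rewrite ImD !ImM /GRing.scale /=; ring.
Qed.

Lemma cderiv_line z t : cderiv (fun s => s%:C%C * z) t z.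
Proof.
split; (under eq_fun do rewrite ?ReM ?ImM /=);
  apply: is_derive_eq; rewrite /GRing.scale /=.
  by ring.
by ring.
Qed.

Lemma cderiv_cexp z t : cderiv (fun s => cexp (s%:C%C * z)) t (z * cexp (t%:C%C * z)).
Proof.
split; rewrite /cexp /= ?ReM ?ImM /= ?mul0r ?subr0 ?addr0;
  (under eq_fun do rewrite ?ReM ?ImM /= ?mul0r ?subr0 ?addr0);
  apply: is_derive_eq; rewrite /GRing.scale /= ?mul0r ?subr0 ?addr0.
  by ring.
by ring.
Qed.

Lemma cderiv_horner (p : {poly C}) z t :
  cderiv (fun s => p.[s%:C%C * z]) t (z * p^`().[t%:C%C * z]).
Proof.
elim/poly_ind: p => [|p c IH].
  rewrite deriv0 horner0 mulr0; under [X in cderiv X]eq_fun do rewrite horner0.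
  exact: cderiv_cst.
under [X in cderiv X]eq_fun do rewrite hornerMXaddC.
have := cderivD (cderivM IH (cderiv_line z t)) (cderiv_cst c t).
rewrite derivD derivM derivX derivC addr0 mulr1 addr0 hornerD hornerM hornerX.
by congr cderiv; ring.
Qed.

(** The mean value theorem holds for each component separately, at possibly
    different points; hence the factor 2. *)
Lemma cderiv_mvt (g dg : R -> C) (B : R) :
  (forall t, cderiv g t (dg t)) -> (forall t, 0 <= t <= 1 -> `|dg t| <= B%:C%C) ->
  `|g 1 - g 0| <= (2 * B)%:C%C.
Proof.
move=> hg hB.
have cont (f df : R -> R) : (forall t, is_derive t 1 f (df t)) -> {within `[0, 1 : R], continuous f}.
  move=> hf; apply: derivable_within_continuous => x _.
  by have := hf x => -[].
have [c hc hRe] := MVT_segment ler01 (fun x _ => (hg x).1) (cont _ _ (fun x => (hg x).1)).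
have [e he hIm] := MVT_segment ler01 (fun x _ => (hg x).2) (cont _ _ (fun x => (hg x).2)).
rewrite (le_trans (norm_le_ReIm _)) // lecR ReB ImB hRe hIm subr0 !mulr1.
rewrite mulr_natl mulr2n lerD // -lecR.
  by apply: le_trans (Re_le_norm _) (hB _ _).
by apply: le_trans (Im_le_norm _) (hB _ _).
Qed.

(** Hermite's operator inverts 1 - d/dx on polynomials, which makes
    - e^(-x) (hermite p)(x) a primitive of e^(-x) p(x). *)
Definition hermite (p : {poly C}) : {poly C} := \sum_(i < size p) p^`(i).

Lemma hermite_deriv p : (hermite p)^`() = hermite p - p.
Proof.
have [->|p0] := eqVneq p 0.
  by rewrite /hermite size_poly0 big_ord0 deriv0 subr0.
rewrite /hermite raddf_sum /= -(prednK (n := size p)) ?size_poly_gt0 //.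
rewrite [in RHS]big_ord_recl derivn0 addrAC subrr add0r big_ord_recr /=.
rewrite -derivnS prednK ?size_poly_gt0 // derivn_poly0 // addr0.
by apply: eq_bigr => i _; rewrite add0n.
Qed.

(** With F = hermite p, the derivative of e^(-tz) F(tz) in t is
    - z e^(-tz) p(tz); so F(z) - e^z F(0) is small when p is small on the segment
    from 0 to z. *)
Lemma hermite_bound (p : {poly C}) z (A M : R) : `|z| <= A%:C%C ->
  (forall t, 0 <= t <= 1 -> `|p.[t%:C%C * z]| <= M%:C%C) ->
  `|(hermite p).[z] - cexp z * (hermite p).[0]| <= (2 * A * expR (2 * A) * M)%:C%C.
Proof.
move=> zA hM.
pose g t := cexp (t%:C%C * - z) * (hermite p).[t%:C%C * z].
pose dg t := - (z * cexp (t%:C%C * - z) * p.[t%:C%C * z]).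
have hg t : cderiv g t (dg t).
  have := cderivM (cderiv_cexp (- z) t) (cderiv_horner (hermite p) z t).
  by rewrite hermite_deriv hornerD hornerN /dg; congr cderiv; ring.
have A0 : 0 <= A by rewrite -lecR; apply: le_trans zA; exact: normr_ge0.
have M0 : 0 <= M.
  by rewrite -lecR; apply: le_trans (hM 0 _); [exact: normr_ge0 | rewrite lexx ler01].
have eA w : `|w| <= A%:C%C -> `|cexp w| <= (expR A)%:C%C.
  move=> wA; rewrite norm_cexp lecR ler_expR (le_trans (ler_norm _)) // -lecR.
  exact: le_trans (Re_le_norm _) wA.
have hdg t : 0 <= t <= 1 -> `|dg t| <= (A * expR A * M)%:C%C.
  move=> t01; rewrite normrN !normrM !rmorphM /=.
  have /andP[t0 t1] := t01.
  rewrite ler_pM ?mulr_ge0 ?normr_ge0 ?hM // ler_pM ?normr_ge0 //.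
  apply: eA; rewrite normrM normrN (le_trans _ zA) //.
  by rewrite ler_piMl // ger0_norm ?ler0c // -(rmorph1 (real_complex R)) lecR.
have := cderiv_mvt hg hdg.
rewrite /g !rmorph1 !rmorph0 !mul1r !mul0r cexp0 mul1r => hh.
have -> : (hermite p).[z] - cexp z * (hermite p).[0] =
    cexp z * (cexp (- z) * (hermite p).[z] - (hermite p).[0]).
  by rewrite mulrBr mulrA -cexpD subrr cexp0 mul1r.
rewrite normrM; apply: le_trans (ler_pM _ _ (eA _ zA) hh) _; rewrite ?normr_ge0 //.
rewrite -rmorphM lecR (_ : expR (2 * A) = expR A * expR A).
  by rewrite le_eqVlt; apply/orP; left; apply/eqP; ring.
by rewrite -expRD mulr_natl mulr2n.
Qed.

End ComplexExp.

(** * Transcendence of pi *)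

(** Conjugates of i pi live in R[i], while the conclusion is about reals. *)
Lemma algebraicOver_real_complex (R : realType) (x : R) :
  algebraicOver (ratr : rat -> R[i]) x%:C%C <-> algebraicOver (ratr : rat -> R) x.
Proof.
have E (p : {poly rat}) : root (map_poly (ratr : rat -> R[i]) p) x%:C%C
    = root (map_poly (ratr : rat -> R) p) x.
  rewrite -(fmorph_root (real_complex R)) -map_poly_comp; congr (root _ _).
  apply: eq_map_poly => y; rewrite -(fmorph_eq_rat (real_complex R \o ratr)) //.
by split=> -[p p0]; [rewrite E|rewrite -E]; exists p.
Qed.

(** If q is an integral polynomial of degree d + 1 with leading coefficient a and
    root x, then a^d q(X / a) is monic, integral, and vanishes at a x. *)
Lemma scaled_conjugates (C : numClosedFieldType) (x : C) :
  algebraicOver (ratr : rat -> C) x ->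
  exists (a : int) (P : {poly int}) (s : seq C),
  [/\ a != 0, map_poly intr P = \prod_(c <- s) ('X - c%:P) & a%:~R * x \in s].
Proof.
move=> [p p0].
have [q [b b0 Ep]] := rat_poly_scale p; rewrite {p}Ep in p0 *.
have q0 : q != 0.
  by apply: contraNneq p0 => ->; rewrite rmorph0 scaler0.
rewrite map_polyZ /= rootZ; last by rewrite fmorph_eq0 invr_eq0 intr_eq0.
rewrite -map_poly_comp (eq_map_poly (g := intr)); last by move=> y; rewrite /= ratr_int.
move=> qx.
have [d dq] : exists d, size q = d.+2.
  case Eq: (size q) => [|[|d]]; last by exists d.
    by move/eqP: Eq; rewrite size_poly_eq0 (negbTE q0).
  move/eqP: Eq => /size_poly1P[c c0 Ec]; move: qx.
  by rewrite Ec map_polyC rootC intr_eq0 (negbTE c0).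
pose a := lead_coef q; have a0 : a != 0 by rewrite lead_coef_eq0.
(* the monic polynomial whose roots are those of q multiplied by a *)
pose P := 'X^(d.+1) + \poly_(i < d.+1) (q`_i * a ^+ (d - i)).
have PM : P \is monic.
  rewrite monicE /P lead_coefDl ?lead_coefXn // size_polyXn ltnS.
  exact: size_poly.
have Px : root (map_poly (intr : int -> C) P) (a%:~R * x).
  rewrite /root rmorphD /= map_polyXn hornerD hornerXn poly_def rmorph_sum horner_sum.
  move: qx; rewrite /root horner_coef size_map_poly_id0 ?intr_eq0 //.
  rewrite dq big_ord_recr /= coef_map /= -[q`_d.+1]/(q`_(d.+2.-1)) -dq -/(lead_coef q) -/a.
  move=> /eqP h; apply/eqP; rewrite -[RHS](mulr0 (a%:~R ^+ d)) -[in RHS]h mulrDr [RHS]addrC.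
  congr (_ + _); first by rewrite exprMn exprS; ring.
  rewrite mulr_sumr; apply: eq_bigr => i _.
  rewrite map_polyZ map_polyXn hornerZ hornerXn coef_map /= rmorphM rmorphXn /=.
  have id : (i <= d)%N by rewrite -ltnS.
  have -> : a%:~R ^+ d = a%:~R ^+ (d - i) * a%:~R ^+ i :> C by rewrite -exprD subnK.
  by rewrite exprMn; ring.
have [s hs] := closed_field_poly_normal (map_poly (intr : int -> C) P).
have lP : lead_coef (map_poly (intr : int -> C) P) = 1.
  by rewrite lead_coef_map_inj ?(monicP PM) ?rmorph1 //; exact: intr_inj.
rewrite lP scale1r in hs.
exists a, P, s; split=> //.
by rewrite -root_prod_XsubC -hs.
Qed.

Lemma derivn_mul_exp_root (C : comNzRingType) (q g : {poly C}) (u : C) (m i : nat) :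
  (i < m)%N -> root q u -> root (g * q ^+ m)^`(i) u.
Proof.
move=> im qu; elim: i m g im => [|i IH] m g im.
  by rewrite derivn0 /root hornerM horner_exp (eqP qu) expr0n gtn_eqF // mulr0.
rewrite derivSn; case: m im => // m im.
rewrite derivM deriv_exp /= (_ : _ + _ = (g^`() * q + g * (q^`() *+ m.+1)) * q ^+ m); last first.
  by rewrite exprS; ring.
exact: IH.
Qed.

(** The Hermite operator in the variable a x: it evaluates hermite of h(a X)
    without leaving the ring of coefficients of h. *)
Definition shermite (C : nzRingType) (a : C) (h : {poly C}) : {poly C} :=
  \sum_(i < size h) a ^+ i *: h^`(i).

Lemma hermite_scale (R : realType) (h : {poly R[i]}) (a : R[i]) x : a != 0 ->
  (hermite (h \Po (a *: 'X))).[x] = (shermite a h).[a * x].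
Proof.
move=> a0.
have D i : (h \Po (a *: 'X))^`(i) = a ^+ i *: (h^`(i) \Po (a *: 'X)).
  elim: i => [|i IH]; first by rewrite !derivn0 expr0 scale1r.
  rewrite derivnS IH derivZ deriv_comp derivZ derivX derivnS exprSr -scalerA.
  by congr (_ *: _); rewrite -scalerAr mulr1.
rewrite /hermite /shermite size_comp_poly2 ?size_scale ?size_polyX //.
rewrite !horner_sum; apply: eq_bigr => i _.
by rewrite D !hornerZ horner_comp hornerZ hornerX.
Qed.

Section HermiteInteger.
Variables (a : int) (T : {poly int}) (p' : nat).
Let p := p'.+1.

(** Up to the factor 1 / (p - 1)!, Hermite's auxiliary polynomial for the prime
    p = p' + 1: it vanishes to order p at the roots of T, but only to order p - 1
    at 0 when T(0) is nonzero. *)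
Definition auxpoly : {poly int} := 'X^p' * T ^+ p.

Lemma size_auxpoly : T != 0 -> (p <= size auxpoly)%N.
Proof.
move=> T0; rewrite /auxpoly mulrC size_mulXn ?expf_neq0 //.
by rewrite -[X in (X <= _)%N]addn1 leq_add2l lt0n size_poly_eq0 expf_neq0.
Qed.

(** At a root of X T the derivatives of order at least p are divisible by p!, as
    h^(i) = i! times an integral polynomial, and those of lower order vanish,
    except the one of order p - 1 at 0.  So the whole is divisible by (p - 1)!,
    and modulo p! only the root 0 contributes. *)
Lemma shermite_aux : T != 0 -> exists H : {poly int}, forall (C : numClosedFieldType) (u : C),
  root (map_poly intr ('X * T)) u ->
  (map_poly intr (shermite a auxpoly)).[u] =
    (u == 0)%:R * (a ^+ p' * T.[0] ^+ p * (p'`!)%:R)%:~R +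
    (p`!)%:R * (map_poly intr H).[u].
Proof.
move=> T0; set h := auxpoly.
have ps := size_auxpoly T0.
exists (\sum_(i < size h | (p <= i)%N) a ^+ i *: (h^`N(i) *+ (i`! %/ p`!))).
move=> C u; rewrite rmorphM /= map_polyX rootM rootX => uT.
rewrite /shermite rmorph_sum horner_sum (bigID (fun i : 'I__ => (p <= i)%N)) /= addrC.
congr (_ + _); last first.
  rewrite rmorph_sum horner_sum mulr_sumr; apply: eq_bigr => i pi.
  rewrite nderivn_def !map_polyZ !hornerZ !rmorphMn /= !hornerMn.
  have dv : (p`! %| i`!)%N by rewrite -(bin_fact pi) dvdn_mull // dvdn_mulr.
  rewrite -[in LHS](divnK dv) mulrnA -[in LHS]mulr_natl.
  by rewrite map_polyZ hornerZ rmorphMn /= hornerMn mulrCA.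
have Eh : map_poly intr h = 'X^p' * (map_poly intr T : {poly C}) ^+ p.
  by rewrite /h /auxpoly rmorphM /= map_polyXn rmorphXn.
have [u0|u0] := eqVneq u 0; last first.
  rewrite mul0r big1 // => i; rewrite -ltnNge => ip.
  rewrite map_polyZ hornerZ -derivn_map Eh (eqP (derivn_mul_exp_root _ ip _)) ?mulr0 //.
  by move: uT; rewrite (negbTE u0).
rewrite mul1r u0 (bigD1 (Ordinal ps)) /=; last by rewrite -ltnNge.
rewrite big1 ?addr0 => [|i /andP[ip iN]]; rewrite map_polyZ hornerZ.
  rewrite !rmorphM /= rmorphXn -mulrA; congr (_ * _).
  rewrite -[0](rmorph0 (intr : {rmorphism int -> C})) horner_map -rmorphM; congr (_%:~R).
  rewrite !horner_coef0 coef_derivn addn0 ffactnn /h /auxpoly coefXnM ltnn subnn.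
  by rewrite -!horner_coef0 horner_exp mulr_natr.
rewrite -[0](rmorph0 (intr : {rmorphism int -> C})) horner_map.
rewrite !horner_coef0 coef_derivn addn0 /h /auxpoly coefXnM.
have -> : (i < p')%N.
  rewrite -ltnNge ltnS in ip; rewrite ltn_neqAle ip andbT.
  by apply: contra iN => /eqP e; apply/eqP/val_inj.
by rewrite mul0rn rmorph0 mulr0.
Qed.

End HermiteInteger.

Lemma exp_lt_fact (R : realType) (c E : R) :
  exists N, forall n, (N <= n)%N -> c * E ^+ n < n`!%:R.
Proof.
have h : (c * exp_coeff E n @[n --> \oo] --> c * 0)%classic.
  by apply: cvgM; [exact: cvg_cst | exact: cvg_exp_coeff].
rewrite mulr0 in h.
have /cvgr_lt := h => /(_ 1 ltr01)[N _ hN]; exists N => n Nn.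
by have := hN n Nn; rewrite /exp_coeff /= mulrA ltr_pdivrMr ?mul1r ?ltr0n ?fact_gt0.
Qed.

Lemma horner_disc_bound (R : realType) (T : {poly int}) (D : R) : 0 <= D ->
  exists2 B : R, 0 <= B & forall w : R[i], `|w| <= D%:C%C ->
  `|(map_poly intr T).[w]| <= B%:C%C.
Proof.
move=> D0; exists (\sum_(i < size T) `|T`_i|%:~R * D ^+ i).
  by apply: sumr_ge0 => i _; rewrite mulr_ge0 ?exprn_ge0 ?ler0z.
move=> w wD; rewrite horner_coef (size_map_inj_poly (@intr_inj _) (mulr0z 1)).
rewrite rmorph_sum /= (le_trans (ler_norm_sum _ _ _)) //; apply: ler_sum => i _.
rewrite coef_map /= normrM normrX rmorphM rmorphXn /= rmorph_int intr_norm.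
by rewrite ler_wpM2l // lerXn2r // ?nnegrE // (le_trans _ wD).
Qed.

(** Lindemann's theorem for pi.  The integer V below is nonzero because the prime
    p divides neither the number k of subsets with sum 0, nor a, nor T(0). *)
Theorem pi_transcendental (R : realType) : ~ algebraicOver (ratr : rat -> R) pi.
Proof.
move=> /algebraicOver_real_complex api; set C := R[i].
have aipi : algebraicOver (ratr : rat -> C) (Complex 0 pi).
  have -> : Complex 0 pi = 'i%C * pi%:C%C :> C.
    by apply/eqP; rewrite eq_complex /=; apply/andP; split; apply/eqP; ring.
  apply: algebraic_mul api; exists ('X^2 + 1).
    by rewrite -size_poly_gt0 -[1]polyC1 size_polyDl ?size_polyXn // size_polyC.
  by rewrite /root rmorphD rmorph1 /= map_polyXn hornerD hornerXn hornerC sqr_i addNr.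
have [a [P [s [a0 Ps ips]]]] := scaled_conjugates aipi.
have hP : map_poly intr P = \prod_(c <- in_tuple s) ('X - c%:P) by [].
pose sub := subsum (in_tuple s).
have aC0 : a%:~R != 0 :> C by rewrite intr_eq0.
(* the expanded product of the 1 + e^c over c in s / a; i pi is one of these c *)
have sum_exp : \sum_S cexp (a%:~R^-1 * sub S) = 0.
  pose e i := cexp (a%:~R^-1 * tnth (in_tuple s) i).
  transitivity (\prod_i (e i + 1)).
    rewrite bigA_distr; apply: eq_bigr => S _.
    rewrite /sub /subsum mulr_sumr cexp_sum big_mkcond /=.
    by apply: eq_bigr => i _; case: ifP.
  have /tnthP[i hi] : a%:~R * Complex 0 pi \in in_tuple s by [].
  by rewrite (bigD1 i) //= /e -hi mulKf // cexp_pi addNr mul0r.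
have [Q hQ] := subsum_poly_int hP.
have Q0 : Q != 0.
  apply: contra_eq_neq hQ => ->; rewrite rmorph0 eq_sym.
  by apply/prodf_neq0 => S _; rewrite polyXsubC_eq0.
have [m [T]] := multiplicity_XsubC Q 0; rewrite Q0 /= subr0 => Tz QE.
have T0 : T != 0 by apply: contraNneq Tz => ->; rewrite root0.
have Troot S : root (map_poly intr ('X * T)) (sub S).
  rewrite rmorphM /= map_polyX rootM rootX; have [//|s0] := eqVneq (sub S) 0.
  have : root (map_poly intr Q) (sub S).
    by rewrite hQ /root horner_prod (bigD1 S) //= hornerXsubC subrr mul0r.
  by rewrite QE rmorphM rmorphXn /= map_polyX rootM /root hornerXn expf_eq0 (negbTE s0) andbF orbF.
have Tz0 : T.[0] != 0 by [].
(* one radius for all subset sums *)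
pose D : R := \sum_S complex.Re `|sub S|.
have normE (w : C) : `|w| = (complex.Re `|w|)%:C%C by rewrite RRe_real // normr_real.
have D0 : 0 <= D.
  by apply: sumr_ge0 => S _; rewrite -lecR -normE normr_ge0.
have subD S : `|sub S| <= D%:C%C.
  rewrite /D rmorph_sum (bigD1 S) //= -normE lerDl sumr_ge0 // => S' _.
  by rewrite -normE normr_ge0.
have [B B0 hB] := horner_disc_bound T D0.
pose k := (\sum_S (sub S == 0%R))%N.
have k0 : (0 < k)%N.
  by rewrite /k (bigD1 finset.set0) //= {1}/sub /subsum big_set0 eqxx.
pose c : R := (2 ^ size s)%:R * (2 * D * expR (2 * D) * B).
have [N hN] := exp_lt_fact c (D * B).
have [p pbig pp] := prime_above (N + k + `|a|%N + `|T.[0]|%N).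
have kp : (k < p)%N by rewrite (leq_ltn_trans _ pbig) // -!addnA addnCA leq_addr.
have ap : (`|a| < p)%N.
  by rewrite (leq_ltn_trans _ pbig) // -addnA addnCA leq_addr.
have tp : (`|T.[0]| < p)%N by rewrite (leq_ltn_trans _ pbig) // leq_addl.
have [p' Ep] : exists p', p = p'.+1 by exists p.-1; rewrite prednK // prime_gt0.
have [H hH] := shermite_aux a p' T0.
have [z hz] := subsum_horner_int hP H.
pose h := auxpoly T p'.
pose V : int := k%:R * (a ^+ p' * T.[0] ^+ p) + p%:R * z.
have sumV : \sum_S (map_poly intr (shermite a h)).[sub S] = (p'`!)%:R * V%:~R.
  rewrite (eq_bigr (fun S => (sub S == 0)%:R * (a ^+ p' * T.[0] ^+ p'.+1 * (p'`!)%:R)%:~R +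
    (p'.+1`!)%:R * (map_poly intr H).[sub S])); last by move=> S _; exact: hH.
  rewrite big_split /= -mulr_suml -mulr_sumr hz -natr_sum -/k.
  by rewrite factS natrM /V Ep rmorphD !rmorphM /= !rmorph_nat; ring.
have V0 : V != 0.
  have hlt (x : int) : x != 0 -> (`|x| < p)%N -> ~~ (p %| x)%Z.
    move=> x0 xp; rewrite dvdzE /=; apply/negP => /dvdn_leq.
    by rewrite absz_gt0 => /(_ x0); rewrite leqNgt xp.
  have pr (x y : int) : ~~ (p %| x)%Z -> ~~ (p %| y)%Z -> ~~ (p %| (x * y))%Z.
    by rewrite !dvdzE abszM /= Euclid_dvdM // => /negbTE-> /negbTE->.
  have prX (x : int) n : ~~ (p %| x)%Z -> ~~ (p %| (x ^+ n))%Z.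
    move=> px; elim: n => [|n IH]; last by rewrite exprS pr.
    by rewrite expr0 dvdzE /= dvdn1 neq_ltn prime_gt1 // orbT.
  have : ~~ (p %| (k%:R * (a ^+ p' * T.[0] ^+ p))%R)%Z.
    apply: (pr); last by apply: (pr); apply: (prX); apply: (hlt).
    by apply: (hlt); [rewrite pnatr_eq0 -lt0n | rewrite natz].
  apply: contraNneq => /eqP; rewrite /V addr_eq0 => /eqP ->.
  by rewrite dvdzE abszN abszM natz dvdn_mulr.
have hpos : `|\sum_S (map_poly intr (shermite a h)).[sub S]| >= ((p'`!)%:R : R)%:C%C.
  rewrite sumV normrM normr_nat rmorph_nat ler_peMr // -intr_norm.
  by rewrite (ler_int _ 1) -gtz0_ge1 normr_gt0.
have hneg : `|\sum_S (map_poly intr (shermite a h)).[sub S]| <= (c * (D * B) ^+ p')%:C%C.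
  pose f : {poly C} := map_poly intr h \Po (a%:~R *: 'X).
  have Ef x : (hermite f).[x] = (map_poly intr (shermite a h)).[a%:~R * x].
    rewrite /f hermite_scale // /shermite rmorph_sum /=.
    rewrite (size_map_inj_poly (@intr_inj _) (mulr0z 1)); congr (_.[_]).
    by apply: eq_bigr => i _; rewrite map_polyZ /= rmorphXn derivn_map.
  have -> : \sum_S (map_poly intr (shermite a h)).[sub S] =
    \sum_S ((hermite f).[a%:~R^-1 * sub S] - cexp (a%:~R^-1 * sub S) * (hermite f).[0]).
    rewrite sumrB -mulr_suml sum_exp mul0r subr0; apply: eq_bigr => S _.
    by rewrite Ef mulVKf.
  apply: le_trans (ler_norm_sum _ _ _) _.
  have -> : (c * (D * B) ^+ p')%:C%C =
      \sum_(S : {set 'I_(size s)}) (2 * D * expR (2 * D) * (D ^+ p' * B ^+ p))%:C%C.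
    rewrite sumr_const -cardsT -powersetT card_powerset cardsT card_ord -rmorphMn /=.
    by congr (_%:C%C); rewrite -mulr_natl /c Ep exprS exprMn; ring.
  apply: ler_sum => S _; apply: hermite_bound.
    rewrite normrM normfV (le_trans _ (subD S)) // ler_piMl // invf_le1 ?normr_gt0 //.
    by rewrite -intr_norm (ler_int _ 1) -gtz0_ge1 normr_gt0.
  move=> t /andP[t0 t1].
  have tD : `|t%:C%C * sub S| <= D%:C%C.
    rewrite normrM (le_trans _ (subD S)) // ler_piMl // ger0_norm ?ler0c //.
    by rewrite -(rmorph1 (real_complex R)) lecR.
  rewrite /f horner_comp hornerZ hornerX mulrCA mulVKf //.
  rewrite /h /auxpoly rmorphM /= map_polyXn rmorphXn hornerM hornerXn horner_exp.
  rewrite normrM !normrX rmorphM !rmorphXn /= -Ep.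
  have [DC BC] : 0 <= D%:C%C /\ 0 <= B%:C%C by rewrite !ler0c.
  apply: ler_pM; rewrite ?exprn_ge0 //; apply: lerXn2r; rewrite ?nnegrE //.
  exact: (hB).
have := le_trans hpos hneg; rewrite lecR leNgt hN //.
by rewrite -ltnS -Ep (leq_ltn_trans _ pbig) // -!addnA leq_addr.
Qed.

(** * Euler's product for the sine *)

Section SineProduct.
Context {R : realType}.
Local Notation mu := lebesgue_measure.
Implicit Types (t x y : R) (n : nat).

Lemma FTC2_closed (F f : R -> R) (a b : R) : a < b ->
  (forall t, a <= t <= b -> is_derive t 1 F (f t)) ->
  (forall t, a <= t <= b -> {for t, continuous f}) ->
  Rintegral mu `[a, b] f = F b - F a.
Proof.
move=> ab dF cf; rewrite /Rintegral (@continuous_FTC2 _ f F) //.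
- apply: continuous_in_subspaceT => t; rewrite inE /= in_itv /=; exact: cf.
- have := derivable_within_continuous (f := F) (i := `[a, b]).
  have dF' : {in `[a, b], forall t, derivable F t 1}.
    by move=> t; rewrite in_itv /= => /dF[].
  move=> /(_ dF') /(continuous_within_itvP _ ab)[_ Fa Fb]; split => //.
  by move=> t /subset_itv_oo_cc /dF'.
- move=> t /subset_itv_oo_cc; rewrite in_itv /= => /dF h.
  by rewrite derive1E derive_val.
Qed.

Lemma continuous_integrable_itv (f : R -> R) (a b : R) :
  (forall t, a <= t <= b -> {for t, continuous f}) ->
  mu.-integrable `[a, b] (EFin \o f).
Proof.
move=> cf; apply: continuous_compact_integrable; first exact: segment_compact.
by apply: continuous_in_subspaceT => t; rewrite inE /= in_itv /=; exact: cf.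
Qed.

Lemma derivable_continuous (f : R -> R) t : derivable f t 1 -> {for t, continuous f}.
Proof. by move=> df; apply: differentiable_continuous; exact/derivable1_diffP. Qed.

(** Stated for the pointwise power, so that instance resolution also applies when
    the exponent is a variable. *)
#[local] Instance is_derive_pow (f : R -> R) n t df : is_derive t 1 f df ->
  is_derive t 1 (fun s => f s ^+ n) (n%:R * f t ^+ n.-1 * df).
Proof.
move=> fdf; have -> : (fun s => f s ^+ n) = f ^+ n.
  by apply/funext => s; elim: n => [|n IH]; rewrite ?expr0 // !exprS IH.
by apply: is_derive_eq.
Qed.

Let g y n t := cos (y * t) * cos t ^+ n.
Definition coscos y n : R := Rintegral mu `[0, pi / 2] (g y n).

Let derivable_g y n t : derivable (g y n) t 1.
Proof.
have h : is_derive t 1 (g y n) (cos (y * t) * (n%:R * (cos t ^+ n.-1 * - sin t)) +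
    cos t ^+ n * (- sin (y * t) * y)).
  by rewrite /g; apply: is_derive_eq; rewrite /GRing.scale /=; ring.
by case: h.
Qed.

Let g_int y n : mu.-integrable `[0, pi / 2] (EFin \o g y n).
Proof.
apply: continuous_integrable_itv => t _; apply: derivable_continuous; exact: derivable_g.
Qed.

Let derivable_int (h : R -> R) : (forall t, derivable h t 1) ->
  mu.-integrable `[0, pi / 2] (EFin \o h).
Proof.
by move=> dh; apply: continuous_integrable_itv => t _; exact: derivable_continuous.
Qed.

Let pihalf_gt0 : 0 < pi / 2 :> R.
Proof. by rewrite divr_gt0 ?pi_gt0. Qed.

(** The combination of the two integrands is the derivative of
    y cos(t)^(n+2) sin(yt) - (n+2) cos(t)^(n+1) sin(t) cos(yt),
    which vanishes at both ends. *)
Lemma coscos_rec y n :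
  (n.+2 * n.+1)%:R * coscos y n = (n.+2%:R ^+ 2 - y ^+ 2) * coscos y n.+2.
Proof.
pose F t := y * (cos t ^+ n.+2 * sin (y * t)) - n.+2%:R * (cos t ^+ n.+1 * (sin t * cos (y * t))).
pose f t := (n.+2 * n.+1)%:R * g y n t - (n.+2%:R ^+ 2 - y ^+ 2) * g y n.+2 t.
have dF t : is_derive t 1 F (f t).
  rewrite /F /f /g; apply: is_derive_eq.
  rewrite /GRing.scale /=.
  have s2 := sin2cos2 t.
  apply/eqP; rewrite -subr_eq0; apply/eqP.
  transitivity ((n.+2 * n.+1)%:R * cos t ^+ n * cos (y * t) * (sin t ^+ 2 - (1 - cos t ^+ 2))).
    by rewrite natrM !exprS; ring.
  by rewrite s2 subrr mulr0.
have cf t : {for t, continuous f}.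
  by apply: derivable_continuous; rewrite /f; apply: derivableB; apply: derivableM.
have := FTC2_closed pihalf_gt0 (fun t _ => dF t) (fun t _ => cf t).
rewrite /F cos_pihalf sin0 !expr0n !mul0r !mulr0 subrr.
rewrite /f RintegralB //; last 2 first.
- by apply: derivable_int => t; apply: derivableM.
- by apply: derivable_int => t; apply: derivableM.
by rewrite !RintegralZl // sin0 !mulr0 !subr0 => /eqP; rewrite subr_eq0 => /eqP.
Qed.

Lemma coscos0 y : y != 0 -> coscos y 0 = sin (y * (pi / 2)) / y.
Proof.
move=> y0.
have dF t : is_derive t 1 (fun t => sin (y * t) / y) (g y 0 t).
  rewrite /g; apply: is_derive_eq; rewrite /GRing.scale /=.
  by rewrite mulr0 add0r expr0 mulr1; field.
rewrite /coscos (FTC2_closed pihalf_gt0 (fun t _ => dF t)) ?mulr0 ?sin0 ?mul0r ?subr0 //.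
by move=> t _; exact: derivable_continuous.
Qed.

Lemma coscos00 : coscos 0 0 = pi / 2.
Proof.
have dF t : is_derive t 1 (@id R) (g 0 0 t).
  by rewrite /g mul0r cos0 expr0 mulr1; apply: is_derive_id.
rewrite /coscos (FTC2_closed pihalf_gt0 (fun t _ => dF t)) ?subr0 //.
by move=> t _; exact: derivable_continuous.
Qed.

Lemma tcos_le_sin t : 0 <= t <= pi / 2 -> t * cos t <= sin t.
Proof.
move=> /andP[t0 tp]; rewrite -subr_ge0.
pose F s := sin s - s * cos s : R.
have dF (s : R) : is_derive s 1 F (s * sin s).
  by rewrite /F; apply: is_derive_eq; rewrite /GRing.scale /=; ring.
have cF : {within `[0, t], continuous F}.
  by apply: derivable_within_continuous => s _; case: (dF s).
have [s + E] := MVT_segment t0 (fun s _ => dF s) cF.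
rewrite in_itv /= => /andP[s0 st].
have -> : sin t - t * cos t = F t - F 0 by rewrite /F sin0 mul0r !subr0.
rewrite E subr0 !mulr_ge0 // sin_ge0_pi // s0 /=.
by rewrite (le_trans st) // (le_trans tp) // ler_pdivrMr // ler_peMr ?pi_ge0 // ler1n.
Qed.

Lemma onem_cos_le t : 1 - cos t <= t ^+ 2 / 2.
Proof.
have sle s : 0 <= s -> sin s <= s :> R.
  move=> s0.
  have cF : {within `[0, s], continuous (@sin R)}.
    by apply: derivable_within_continuous => r _; case: (is_derive_sin r).
  have [r _] := MVT_segment s0 (fun s _ => is_derive_sin s) cF.
  by rewrite sin0 !subr0 => ->; rewrite ler_piMl // cos_le1.
wlog t0 : t / 0 <= t.
  move=> h; have [|/ltW t0] := leP 0 t; first exact: h.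
  by rewrite -cosN -sqrrN h // oppr_ge0.
pose F s := s ^+ 2 / 2 + cos s : R.
have dF (s : R) : is_derive s 1 F (s - sin s).
  by rewrite /F; apply: is_derive_eq; rewrite /GRing.scale /=; field.
have cF : {within `[0, t], continuous F}.
  by apply: derivable_within_continuous => s _; case: (dF s).
have [s + E] := MVT_segment t0 (fun s _ => dF s) cF.
rewrite in_itv /= => /andP[s0 st].
rewrite lerBlDr -subr_ge0.
have -> : t ^+ 2 / 2 + cos t - 1 = F t - F 0 by rewrite /F cos0 expr0n /=; field.
by rewrite E subr0 mulr_ge0 // subr_ge0 sle.
Qed.

(** The bound 1 - cos(yt) <= (yt)^2 / 2 leaves t^2 cos(t)^(n+2); since
    t cos t <= sin t, this is at most sin(t)^2 cos(t)^n, whose integral is a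
    difference of consecutive values at y = 0. *)
Lemma coscos_sub_le y n :
  0 <= coscos 0 n.+2 - coscos y n.+2 <= y ^+ 2 / 2 * (coscos 0 n - coscos 0 n.+2).
Proof.
have dB y1 n1 y2 n2 t : derivable (fun s => g y1 n1 s - g y2 n2 s) t 1.
  exact: derivableB.
have IB y1 n1 y2 n2 : coscos y1 n1 - coscos y2 n2 =
    Rintegral mu `[0, pi / 2] (fun s => g y1 n1 s - g y2 n2 s).
  by rewrite RintegralB.
rewrite !IB -RintegralZl //; last exact: derivable_int.
have c0 t : 0 <= t <= pi / 2 -> 0 <= cos t.
  move=> /andP[t0 tp]; apply: cos_ge0_pihalf.
  by rewrite tp andbT (le_trans _ t0) // oppr_le0 ltW.
have E t : g 0 n.+2 t - g y n.+2 t = (1 - cos (y * t)) * cos t ^+ n.+2.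
  by rewrite /g mul0r cos0 mulrBl.
apply/andP; split.
  apply: Rintegral_ge0 => t; rewrite /= in_itv /= => /c0 ct.
  by rewrite E mulr_ge0 ?exprn_ge0 // subr_ge0 cos_le1.
apply: le_Rintegral => //.
- exact: derivable_int.
- by apply: derivable_int => t; apply: derivableM.
move=> t; rewrite /= in_itv /= => t01; have ct := c0 _ t01.
rewrite E.
have -> : y ^+ 2 / 2 * (g 0 n t - g 0 n.+2 t) = y ^+ 2 / 2 * sin t ^+ 2 * cos t ^+ n.
  by rewrite /g mul0r cos0 sin2cos2 !exprS; ring.
rewrite [cos t ^+ n.+2]exprS [cos t ^+ n.+1]exprS !mulrA ler_wpM2r ?exprn_ge0 //.
rewrite -mulrA -expr2.
apply: (@le_trans _ _ ((y * t) ^+ 2 / 2 * cos t ^+ 2)).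
  by rewrite ler_wpM2r ?sqr_ge0 // onem_cos_le.
have -> : (y * t) ^+ 2 / 2 * cos t ^+ 2 = y ^+ 2 / 2 * (t * cos t) ^+ 2 by rewrite !exprMn; ring.
have /andP[t0 _] := t01.
rewrite -[X in _ <= X]mulrA -expr2 ler_wpM2l ?divr_ge0 ?sqr_ge0 // lerXn2r ?nnegrE ?mulr_ge0 //; last exact: tcos_le_sin.
by rewrite (le_trans _ (tcos_le_sin t01)) ?mulr_ge0.
Qed.

End SineProduct.

Section SineProduct2.
Context {R : realType}.
Implicit Types (x : R) (m : nat).
Local Notation J := (@coscos R).

Let W m := J 0 m.*2.

Lemma coscos_pos m : 0 < W m.
Proof.
elim: m => [|m IH]; first by rewrite /W coscos00 divr_gt0 ?pi_gt0.
have := coscos_rec (0 : R) m.*2; rewrite expr0n /= subr0 -/(W m) -doubleS -/(W m.+1) => E.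
by rewrite -(pmulr_rgt0 _ (exprn_gt0 2 (ltr0Sn R m.*2.+1))) -E mulr_gt0.
Qed.

(** The tail of the sine product, that is the product of the 1 - x^2 / k^2 over
    all k > m, as a quotient of integrals. *)
Definition sine_tail x m := J (2 * x) m.*2 / J 0 m.*2.

(** The recurrence at 2x divided by the recurrence at 0. *)
Lemma sine_tail_rec x m : sine_tail x m = (1 - x ^+ 2 / m.+1%:R ^+ 2) * sine_tail x m.+1.
Proof.
have E1 := coscos_rec (2 * x) m.*2; have E0 := coscos_rec (0 : R) m.*2.
rewrite -doubleS expr0n /= subr0 in E0; rewrite -doubleS in E1.
rewrite /sine_tail.
have W0 : J 0 m.*2 != 0 by rewrite gt_eqF // coscos_pos.
have W1 : J 0 m.+1.*2 != 0 by rewrite gt_eqF // coscos_pos.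
apply: (mulIf W0); rewrite divfK //.
have n0 : (m.+1.*2 * m.*2.+1)%:R != 0 :> R by rewrite pnatr_eq0.
apply: (mulfI n0).
rewrite mulrCA E0 E1 -[in m.+1.*2%:R]muln2 natrM; field.
by rewrite W1 nat1r pnatr_eq0.
Qed.

Lemma sine_product x m : x != 0 ->
  sin (pi * x) = pi * x * \prod_(k < m) (1 - x ^+ 2 / k.+1%:R ^+ 2) * sine_tail x m.
Proof.
move=> x0; elim: m => [|m ->].
  rewrite big_ord0 mulr1 /sine_tail coscos0 ?mulf_neq0 ?pnatr_eq0 // coscos00.
  have -> : 2 * x * (pi / 2) = pi * x by field.
  have p0 : pi != 0 :> R by rewrite gt_eqF ?pi_gt0.
  by move: (sin (pi * x)) p0; move: (pi : R) => p S p0; field; rewrite p0 x0.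
by rewrite big_ord_recr /= sine_tail_rec; ring.
Qed.

Lemma sine_tail_cvg x : (sine_tail x m @[m --> \oo] --> (1 : R))%classic.
Proof.
have B m : `|sine_tail x m.+1 - 1| <= 2 * x ^+ 2 * m.+1%:R^-1.
  have /andP[l u] := coscos_sub_le (2 * x) m.*2.
  have W1 : 0 < J 0 m.+1.*2 by rewrite coscos_pos.
  have -> : sine_tail x m.+1 - 1 = - ((J 0 m.+1.*2 - J (2 * x) m.+1.*2) / J 0 m.+1.*2).
    by rewrite /sine_tail; field; rewrite gt_eqF.
  rewrite normrN ger0_norm ?divr_ge0 ?(ltW W1) // ler_pdivrMr // (le_trans u) //.
  have E0 := coscos_rec (0 : R) m.*2; rewrite -doubleS expr0n /= subr0 in E0.
  have -> : J 0 m.*2 - J 0 m.+1.*2 = (m.*2.+1)%:R^-1 * J 0 m.+1.*2.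
    have n0 : (m.+1.*2 * m.*2.+1)%:R != 0 :> R by rewrite pnatr_eq0.
    apply: (mulfI n0); rewrite mulrBr E0 doubleS natrM -[m.*2.+2%:R]natr1; field.
    by rewrite nat1r pnatr_eq0.
  rewrite mulrA ler_wpM2r ?(ltW W1) //.
  have -> : (2 * x) ^+ 2 / 2 = 2 * x ^+ 2 by field.
  apply: ler_wpM2l; first by rewrite mulr_ge0 ?sqr_ge0.
  by rewrite lef_pV2 ?posrE ?ltr0n // ler_nat ltnS -addnn leq_addr.
apply/cvgrPdist_le => /= e e0.
have /cvgrPdist_le/(_ e e0)[N _ hN] : (2 * x ^+ 2 * m.+1%:R^-1 @[m --> \oo] --> (0 : R))%classic.
  rewrite -[0 in X in _ --> X](mulr0 (2 * x ^+ 2)); apply: cvgM; first exact: cvg_cst.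
  exact: cvg_harmonic.
exists N.+1 => // -[//|m] Nm /=.
have := hN m Nm; rewrite /= sub0r normrN ger0_norm; last first.
  by apply: divr_ge0 => //; rewrite mulr_ge0 ?sqr_ge0.
by apply: le_trans; rewrite distrC.
Qed.
End SineProduct2.

(** * Integration over the positive half-line *)

Section HalfLine.
Context {R : realType}.
Local Notation mu := (@lebesgue_measure R).
Local Notation pos := (`]0, +oo[%classic : set R).
Implicit Types (f g F : R -> R) (t a b : R).

Let K (n : nat) : set R := `[n.+1%:R^-1, n.+1%:R]%classic.

Let bigcupK : \bigcup_n K n = pos.
Proof.
apply/seteqP; split => t /=.
  by move=> [n _]; rewrite /K /= !in_itv /= andbT => /andP[+ _]; apply: lt_le_trans.
rewrite in_itv /= andbT => t0.
exists (Num.truncn (t + t^-1)) => //.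
have ti0 : 0 < t^-1 by rewrite invr_gt0.
have h := truncnS_gt (t + t^-1).
have h1 : t + t^-1 <= (Num.truncn (t + t^-1)).+1%:R := ltW h.
rewrite /K /= in_itv /=; apply/andP; split.
  rewrite -[leRHS]invrK lef_pV2 ?posrE // (le_trans _ h1) // lerDr ltW //.
by rewrite (le_trans _ h1) // lerDl ltW.
Qed.

Let homoK : {homo K : n m / (n <= m)%N >-> (n <= m)%O}.
Proof.
move=> n m nm; apply/subsetPset => t; rewrite /K /= !in_itv /= => /andP[h1 h2].
apply/andP; split.
  by rewrite (le_trans _ h1) // lef_pV2 ?posrE // ler_nat.
by rewrite (le_trans h2) // ler_nat.
Qed.

Let Kpos n : K n `<=` pos.
Proof. by rewrite -bigcupK => t Kt; exists n. Qed.

Let KltN n : (n.+2%:R^-1 : R) < n.+2%:R.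
Proof.
by rewrite (@lt_trans _ _ 1) // ?invf_lt1 // ltr1n.
Qed.

Let ecvgK f : (forall t, 0 < t -> 0 <= f t) -> measurable_fun pos f ->
  ((\int[mu]_(t in K n) (f t)%:E)%E @[n --> \oo] --> (\int[mu]_(t in pos) (f t)%:E)%E).
Proof.
move=> f0 mf; rewrite -bigcupK.
apply: ge0_nondecreasing_set_cvg_integral => //.
- by move=> i; exact: measurable_itv.
- move=> i; apply/measurable_EFinP; apply: measurable_funS mf => //; exact: measurable_itv.
- by move=> i t /Kpos; rewrite /= in_itv /= andbT lee_fin => /f0.
Qed.

(** The half-line is exhausted by the compact intervals from 1/(n+2) to n+2, on
    which the fundamental theorem of calculus applies. *)
Lemma cvg_Rintegral_pos f : (forall t, 0 < t -> 0 <= f t) ->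
  mu.-integrable pos (EFin \o f) ->
  (Rintegral mu (K n.+1) f @[n --> \oo] --> Rintegral mu pos f).
Proof.
move=> f0 intf.
have mf : measurable_fun pos f by case/integrableP: intf => /measurable_EFinP.
have := ecvgK f0 mf; rewrite -cvg_shiftS => h.
apply: fine_cvg; rewrite fineK //; exact: integrable_fin_num.
Qed.

(** Monotone convergence: a nonnegative function with a bounded primitive is
    integrable. *)
Lemma ge0_primitive_integrable f F (M : R) : (forall t, 0 < t -> 0 <= f t) ->
  (forall t, 0 < t -> is_derive t 1 F (f t)) ->
  (forall t, 0 < t -> {for t, continuous f}) ->
  (forall a b, 0 < a -> a < b -> F b - F a <= M) ->
  mu.-integrable pos (EFin \o f).
Proof.
move=> f0 dF cf FM.
have mf : measurable_fun pos f.
  apply: open_continuous_measurable_fun; first exact: interval_open.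
  by move=> t; rewrite inE /= in_itv /= andbT; exact: cf.
apply/integrableP; split; first exact/measurable_EFinP.
have -> : (\int[mu]_(t in pos) `|(EFin \o f) t| = \int[mu]_(t in pos) (f t)%:E)%E.
  apply: eq_integral.
  by move=> t; rewrite inE /= in_itv /= andbT => t0; rewrite ger0_norm ?f0.
apply: (@le_lt_trans _ _ M%:E); last by rewrite ltry.
have := ecvgK f0 mf; rewrite -cvg_shiftS => h.
apply: (cvge_le _ h); apply: nearW => n /=.
have Kp t : n.+2%:R^-1 <= t <= n.+2%:R -> 0 < t.
  by move=> /andP[+ _]; apply: lt_le_trans; rewrite invr_gt0.
have E := FTC2_closed (KltN n) (fun t ht => dF t (Kp t ht)) (fun t ht => cf t (Kp t ht)).
have intK : mu.-integrable (K n.+1) (EFin \o f).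
  by apply: continuous_integrable_itv => t ht; exact: cf (Kp t ht).
rewrite -[X in (X <= _)%E]fineK; last by apply: integrable_fin_num; [exact: measurable_itv | exact: intK].
by rewrite lee_fin -/(Rintegral _ _ _) E FM // invr_gt0.
Qed.

(** An improper fundamental theorem of calculus.  The integrand is split as f - g
    with f and g nonnegative, because monotone convergence is applied to each. *)
Lemma primitive_RintegralB f g F (l0 ly : R) :
  (forall t, 0 < t -> 0 <= f t) -> (forall t, 0 < t -> 0 <= g t) ->
  (forall t, 0 < t -> {for t, continuous f}) ->
  (forall t, 0 < t -> {for t, continuous g}) ->
  mu.-integrable pos (EFin \o f) -> mu.-integrable pos (EFin \o g) ->
  (forall t, 0 < t -> is_derive t 1 F (f t - g t)) ->
  F (n.+2%:R^-1) @[n --> \oo] --> l0 -> F n.+2%:R @[n --> \oo] --> ly ->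
  Rintegral mu pos f - Rintegral mu pos g = ly - l0.
Proof.
move=> f0 g0 cf cg intf intg dF F0 Fy.
have hf := cvg_Rintegral_pos f0 intf; have hg := cvg_Rintegral_pos g0 intg.
have Kp n t : n.+2%:R^-1 <= t <= n.+2%:R -> 0 < t.
  by move=> /andP[+ _]; apply: lt_le_trans; rewrite invr_gt0.
have E n : Rintegral mu (K n.+1) f - Rintegral mu (K n.+1) g = F n.+2%:R - F n.+2%:R^-1.
  rewrite -RintegralB.
  - apply: FTC2_closed => // t ht; first exact: dF (Kp n t ht).
    by apply: continuousB; [exact: cf (Kp n t ht)|exact: cg (Kp n t ht)].
  - exact: measurable_itv.
  - by apply: continuous_integrable_itv => t ht; exact: cf (Kp n t ht).
  - by apply: continuous_integrable_itv => t ht; exact: cg (Kp n t ht).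
have h1 : (Rintegral mu (K n.+1) f - Rintegral mu (K n.+1) g @[n --> \oo] -->
   Rintegral mu pos f - Rintegral mu pos g) by apply: cvgB.
have h2 : (Rintegral mu (K n.+1) f - Rintegral mu (K n.+1) g @[n --> \oo] --> ly - l0).
  have -> : (fun n => Rintegral mu (K n.+1) f - Rintegral mu (K n.+1) g) =
      (fun n => F n.+2%:R - F n.+2%:R^-1) by apply/funext => n; exact: E.
  exact: cvgB.
exact: (cvg_unique _ h1 h2).
Qed.

End HalfLine.

(** * The Gamma integral and its derivatives *)

Section GammaIntegral.
Context {R : realType}.
Local Notation mu := (@lebesgue_measure R).
Local Notation pos := (`]0, +oo[%classic : set R).
Implicit Types (s t x a b : R) (n : nat).

Lemma pow_le_expR n t : 0 <= t -> t ^+ n <= n`!%:R * expR t.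
Proof.
move=> t0; case: n => [|n].
  by rewrite expr0 fact0 mul1r -expR0 ler_expR.
have h := expR_ge1Dxn n t0; rewrite mulrC -ler_pdivrMr ?ltr0n ?fact_gt0 //.
by apply: le_trans h; rewrite lerDr.
Qed.

Lemma powR_expR_ln a t : 0 < t -> t `^ a = expR (a * ln t).
Proof. by move=> t0; rewrite /powR gt_eqF. Qed.

(** The n-th derivative in x of the integrand of Euler's integral. *)
Definition gamma_kernel n x t : R := ln t ^+ n * (t `^ (x - 1) * expR (- t)).

Lemma measurable_gamma_kernel n x :
  @measurable_fun _ _ (measurableTypeR R) _ pos (gamma_kernel n x).
Proof.
apply: (measurable_funS measurableT) => //.
apply: measurable_funM; first by apply: measurable_funX; exact: measurable_ln.
apply: measurable_funM; first exact: measurable_powR.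
by apply: measurableT_comp; [exact: measurable_expR | exact: oppr_measurable].
Qed.

Lemma powR_le_add a b s t : 0 < t -> a <= s <= b -> t `^ s <= t `^ a + t `^ b.
Proof.
move=> t0 /andP[as_ sb]; have [t1|t1] := leP 1 t.
  by rewrite (le_trans (ler_powR t1 sb)) // lerDr powR_ge0.
by rewrite (le_trans (ger_powR _ as_)) ?lerDl ?powR_ge0 // t0 ltW.
Qed.

(** The logarithm is absorbed by a small power of t on either side of 1:
    (d |ln t|)^n / n! <= e^(d |ln t|). *)
Lemma ln_pow_le (d : R) n t : 0 < d -> 0 < t ->
  `|ln t| ^+ n <= n`!%:R / d ^+ n * (t `^ d + t `^ (- d)).
Proof.
move=> d0 t0.
have h : (d * `|ln t|) ^+ n <= n`!%:R * (t `^ d + t `^ (- d)).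
  apply: le_trans (pow_le_expR n _) _; first by rewrite mulr_ge0 // ltW.
  rewrite ler_wpM2l // !powR_expR_ln //.
  case: ger0P => l0; first by rewrite lerDl expR_ge0.
  by rewrite mulrN -mulNr lerDr expR_ge0.
rewrite exprMn in h.
by rewrite mulrAC ler_pdivlMr ?exprn_gt0 // mulrC.
Qed.

(** The dominating function for all exponents in an interval at once, with no
    logarithm left. *)
Lemma gamma_kernel_bound (d a b : R) n s t : 0 < d -> 0 < t ->
  a + d <= s <= b - d ->
  `|gamma_kernel n s t| <=
    n`!%:R / d ^+ n * 2 * (gamma_kernel 0 a t + gamma_kernel 0 b t).
Proof.
move=> d0 t0 /andP[as_ sb].
have p0 r : 0 <= t `^ r by exact: powR_ge0.
rewrite /gamma_kernel !expr0 !mul1r -mulrDl normrM normrX.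
rewrite [`|_ * expR _|]ger0_norm ?mulr_ge0 ?expR_ge0 // !mulrA ler_wpM2r ?expR_ge0 //.
apply: le_trans (ler_wpM2r (p0 _) (ln_pow_le n d0 t0)) _.
rewrite -!mulrA ler_wpM2l // ler_wpM2l ?invr_ge0 ?exprn_ge0 ?(ltW d0) //.
rewrite mulrDl mulr_natl mulr2n.
have tn0 r : (r == 0) ==> (t != 0) by rewrite gt_eqF ?implybT.
rewrite -!powRD ?tn0 //. apply: lerD; apply: powR_le_add => //; apply/andP; split; lra.
Qed.

(* prim x t is (t / (1 + t))^x, a bounded increasing function *)
Let prim x t := expR (x * (ln t - ln (1 + t))).
Let dprim x t := prim x t * (x * (t^-1 - (1 + t)^-1)).

Let is_derive_prim x t : 0 < t -> is_derive t 1 (prim x) (dprim x t).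
Proof.
move=> t0; have t1 : 0 < 1 + t by rewrite addr_gt0.
have h1 := is_derive1_ln t0; have h2 := is_derive1_ln t1.
rewrite /dprim /prim; apply: is_derive_eq; rewrite /GRing.scale /= .
by ring.
Qed.

(** The function t^(x-1) e^(-t) is dominated, on both ends of the half-line, by
    the derivative of the bounded function (t / (1 + t))^x, which is
    x t^(x-1) / (1 + t)^(x+1). *)
Lemma gamma_kernel0_integrable x : 0 < x -> mu.-integrable pos (EFin \o gamma_kernel 0 x).
Proof.
move=> x0.
have t1 t : 0 < t -> 0 < 1 + t by move=> ?; rewrite addr_gt0.
have dprimE t : 0 < t -> dprim x t = x * (t `^ x / t) * ((1 + t) `^ (x + 1))^-1.
  move=> t0; rewrite /dprim /prim !powR_expR_ln ?t1 // mulrBr expRB mulrDl mul1r expRD.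
  rewrite lnK ?posrE ?t1 //; field.
  by rewrite !gt_eqF ?expR_gt0 ?t1.
have dprim_ge0 t : 0 < t -> 0 <= dprim x t.
  move=> t0; rewrite dprimE // divr_ge0 ?powR_ge0 //.
  by rewrite mulr_ge0 ?(ltW x0) // divr_ge0 ?powR_ge0 // ltW.
have intp : mu.-integrable pos (EFin \o dprim x).
  apply: (@ge0_primitive_integrable _ _ (prim x) 1) => //.
  - by move=> t; exact: is_derive_prim.
  - move=> t t0; apply: derivable_continuous.
    have h := is_derive_prim x t0; rewrite /dprim.
    apply: derivableM; first by case: h.
    apply: derivableM; first exact: derivable_cst.
    apply: derivableB; apply: derivableV; rewrite ?gt_eqF ?t1 //.
  - move=> a b a0 ab; have b0 : 0 < b by exact: lt_trans ab.
    have p1 : prim x b <= expR 0.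
      rewrite /prim ler_expR mulr_ge0_le0 ?(ltW x0) // subr_le0 ler_ln ?posrE ?t1 //.
      by rewrite lerDr.
    by rewrite lerBlDr (le_trans p1) // expR0 lerDl expR_ge0.
pose N := (Num.truncn (x + 1)).+1.
pose c := N`!%:R * expR 1 / x.
apply: (le_integrable _ _ _ (integrableZl _ c intp)); try exact: measurable_itv.
- by apply/measurable_EFinP; refine (measurable_gamma_kernel _ _).
- move=> t; rewrite /= in_itv /= andbT => t0.
  rewrite lee_fin.
  have k0 : 0 <= gamma_kernel 0 x t.
    by rewrite /gamma_kernel expr0 mul1r mulr_ge0 ?powR_ge0 ?expR_ge0.
  have c0 : 0 <= c by rewrite divr_ge0 ?mulr_ge0 ?expR_ge0 // ltW.
  rewrite (ger0_norm k0) ger0_norm; last exact: mulr_ge0 c0 (dprim_ge0 _ t0).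
  rewrite /gamma_kernel expr0 mul1r dprimE // powRB; last by rewrite (gt_eqF t0) implybT.
  rewrite powRr1 ?(ltW t0) //.
  have -> : c * (x * (t `^ x / t) * ((1 + t) `^ (x + 1))^-1) =
      t `^ x / t * (N`!%:R * expR 1 / (1 + t) `^ (x + 1)).
    by rewrite /c; field; rewrite !gt_eqF ?powR_gt0 ?t1.
  rewrite ler_wpM2l ?divr_ge0 ?powR_ge0 ?(ltW t0) //.
  rewrite ler_pdivlMr ?powR_gt0 ?t1 // expRN mulrC ler_pdivrMr ?expR_gt0 //.
  rewrite -mulrA -expRD (le_trans _ (pow_le_expR _ (ltW (t1 _ t0)))) //.
  rewrite -powR_mulrn ?(ltW (t1 _ t0)) // ler_powR ?lerDl ?(ltW t0) //.
  exact: ltW (truncnS_gt _).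
Qed.

Lemma gamma_kernel_integrable n x : 0 < x -> mu.-integrable pos (EFin \o gamma_kernel n x).
Proof.
move=> x0; pose d := x / 2; have d0 : 0 < d by rewrite divr_gt0.
pose C := n`!%:R / d ^+ n * 2.
have i1 := gamma_kernel0_integrable d0.
have i2 := gamma_kernel0_integrable (addr_gt0 x0 d0).
apply: (le_integrable _ _ _ (integrableZl _ C (integrableD _ i1 i2))); try exact: measurable_itv.
- by apply/measurable_EFinP; refine (measurable_gamma_kernel _ _).
- move=> t; rewrite /= in_itv /= andbT => t0; rewrite lee_fin.
  apply: le_trans (ler_norm _); apply: gamma_kernel_bound => //.
  by apply/andP; split; rewrite /d; lra.
Qed.

Definition gamma_moment n x : R := Rintegral mu pos (gamma_kernel n x).

Lemma euler_integralE x : euler_integral x = gamma_moment 0 x.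
Proof.
by congr Rintegral; apply/funext => t; rewrite /gamma_kernel expr0 mul1r.
Qed.

Let is_derive_kernel n t s : 0 < t ->
  is_derive s 1 (fun x => gamma_kernel n x t) (gamma_kernel n.+1 s t).
Proof.
move=> t0; have -> : (fun x => gamma_kernel n x t) =
    (fun x => ln t ^+ n * (expR ((x - 1) * ln t) * expR (- t))).
  by apply/funext => x; rewrite /gamma_kernel powR_expR_ln.
rewrite /gamma_kernel powR_expR_ln //; apply: is_derive_eq.
rewrite /GRing.scale /= exprS; ring.
Qed.

(** Differentiation under the integral sign, for exponents between x / 2 and
    x + 1. *)
Lemma is_derive_gamma_moment n x : 0 < x ->
  is_derive x 1 (gamma_moment n) (gamma_moment n.+1 x).
Proof.
move=> x0.
(* a margin d on both sides of the interval from u to v leaves the positive exponents d and b *)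
pose u := x / 2; pose v := x + 1; pose d := x / 4; pose b := v + d.
have [u0 v0 d0 b0] : [/\ 0 < u, 0 < v, 0 < d & 0 < b].
  by split; rewrite /b /u /v /d; lra.
pose C := n.+1`!%:R / d ^+ n.+1 * 2.
pose G t := `|C * (gamma_kernel 0 d t + gamma_kernel 0 b t)|.
have Ix : (`]u, v[%classic : set R) x by rewrite /= in_itv /= /u /v; apply/andP; split; lra.
have Ip s : (`]u, v[%classic : set R) s -> 0 < s.
  by rewrite /= in_itv /= => /andP[+ _]; apply: lt_trans.
have Bp t : pos t -> 0 < t by rewrite /= in_itv /= andbT.
have iG : mu.-integrable pos (EFin \o G).
  have i1 := gamma_kernel0_integrable d0; have i2 := gamma_kernel0_integrable b0.
  by apply: (integrable_norm (integrableZl _ C (integrableD _ i1 i2))); exact: measurable_itv.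
have intf s : (`]u, v[%classic : set R) s -> mu.-integrable pos (EFin \o gamma_kernel n s).
  by move=> /Ip; exact: gamma_kernel_integrable.
have derf s t : (`]u, v[%classic : set R) s -> pos t ->
    derivable (fun x => gamma_kernel n x t) s 1.
  by move=> _ /Bp t0; case: (is_derive_kernel n s t0).
have pE s t : 0 < t -> partial1of2 (gamma_kernel n) s t = gamma_kernel n.+1 s t.
  by move=> t0; rewrite partial1of2E; case: (is_derive_kernel n s t0).
have Gub s t : (`]u, v[%classic : set R) s -> pos t ->
    `|partial1of2 (gamma_kernel n) s t| <= G t.
  move=> Is /Bp t0; rewrite pE //; apply: le_trans (ler_norm _).
  apply: gamma_kernel_bound => //; move: Is; rewrite /= in_itv /= => /andP[us sv].
  by apply/andP; split; rewrite /b /d /u in us *; lra.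
have G0 t : 0 <= G t by exact: normr_ge0.
have E := @differentiation_under_integral _ _ _ mu _ _ (measurable_itv _) _ _ _ Ix intf derf _ G0 iG Gub.
have D := @derivable_under_integral _ _ _ mu _ _ (measurable_itv _) _ _ _ Ix intf derf _ G0 iG Gub.
apply: DeriveDef; first exact: D.
rewrite -derive1E E; apply: eq_Rintegral => t; rewrite inE => /Bp t0.
exact: pE.
Qed.

End GammaIntegral.

(** * The functional equation and the reflection formula *)

Section Reflection.
Context {R : realType}.
Local Notation mu := (@lebesgue_measure R).
Local Notation pos := (`]0, +oo[%classic : set R).
Implicit Types (s t x a b : R) (n m : nat).
Local Notation G := (@gamma_moment R 0).

Let kernelE a t : gamma_kernel 0 a t = t `^ (a - 1) * expR (- t).
Proof. by rewrite /gamma_kernel expr0 mul1r. Qed.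

Let kernel_ge0 a t : 0 <= gamma_kernel 0 a t.
Proof. by rewrite kernelE mulr_ge0 ?powR_ge0 ?expR_ge0. Qed.

Let is_derive_powexp a t : 0 < t ->
  is_derive t 1 (fun s => s `^ a * expR (- s))
    (a * gamma_kernel 0 a t - gamma_kernel 0 (a + 1) t).
Proof.
move=> t0; have h := is_derive1_powR a t0.
apply: is_derive_eq; rewrite /GRing.scale /= !kernelE addrK; ring.
Qed.

Let kernel_continuous a t : 0 < t -> {for t, continuous (gamma_kernel 0 a)}.
Proof.
move=> t0; apply: derivable_continuous.
have -> : gamma_kernel 0 a = (fun s => s `^ (a - 1) * expR (- s)).
  by apply/funext => s; rewrite kernelE.
by case: (is_derive_powexp (a - 1) t0).
Qed.

Let cvg_inv_nat : (n.+2%:R^-1 : R) @[n --> \oo] --> (0 : R).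
Proof.
have := @cvg_harmonic R; rewrite -(cvg_shiftS _ (nbhs (0 : R))); exact.
Qed.

Let cvg_powexp_y a : n.+2%:R `^ a * expR (- n.+2%:R) @[n --> \oo] --> (0 : R).
Proof.
pose N := (Num.truncn (a + 1)).+1.
have B n : 0 <= (n.+2%:R : R) `^ a * expR (- n.+2%:R) <= N`!%:R * n.+2%:R^-1.
  rewrite mulr_ge0 ?powR_ge0 ?expR_ge0 //= expRN ler_pdivrMr ?expR_gt0 //.
  rewrite mulrAC ler_pdivlMr // (le_trans _ (pow_le_expR _ _)) //.
  rewrite -{2}[n.+2%:R]powRr1 // -powRD; last by rewrite pnatr_eq0 implybT.
  rewrite -powR_mulrn // ler_powR ?ler1n //.
  exact: ltW (truncnS_gt _).
apply: (@squeeze_cvgr _ _ _ _ (cst 0) (fun n => N`!%:R * n.+2%:R^-1)).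
- by apply: nearW => n; exact: B.
- exact: cvg_cst.
- by rewrite -[X in _ --> X](mulr0 (N`!%:R : R)); exact: (cvgM (cvg_cst _) cvg_inv_nat).
Qed.

(** Integration by parts: t^x e^(-t) tends to 0 at both ends. *)
Lemma gamma_moment_rec x : 0 < x -> G (x + 1) = x * G x.
Proof.
move=> x0; have x1 : 0 < x + 1 by rewrite addr_gt0.
have ix := gamma_kernel_integrable 0 x0.
rewrite /gamma_moment -RintegralZl //.
suff : Rintegral mu pos (fun t => x * gamma_kernel 0 x t) -
    Rintegral mu pos (gamma_kernel 0 (x + 1)) = 0 - 0.
  by move/eqP; rewrite subrr subr_eq0 => /eqP.
have h1 := @cvg_powexp_y x.
apply: (primitive_RintegralB (F := fun s => s `^ x * expR (- s))) => //.
- by move=> t _; rewrite mulr_ge0 // ltW.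
- by move=> t t0; apply: continuousM; [exact: cvg_cst | exact: kernel_continuous].
- by move=> t; exact: kernel_continuous.
- by apply: (integrableZl _ x ix); exact: measurable_itv.
- exact: gamma_kernel_integrable.
- by move=> t; exact: is_derive_powexp.
have h : (n.+2%:R^-1 : R) `^ x @[n --> \oo] --> (0 : R).
  by have /cvg_at_rightP := powR_cvg0 x0; apply; split => // n; rewrite invr_gt0.
apply: (@squeeze_cvgr _ _ _ _ (cst 0) (fun n => (n.+2%:R^-1 : R) `^ x)) => //.
  apply: nearW => n; rewrite mulr_ge0 ?powR_ge0 ?expR_ge0 //=.
  by rewrite ler_piMr ?powR_ge0 // -expR0 ler_expR oppr_le0 invr_ge0.
exact: cvg_cst.
Qed.

Lemma gamma_moment1 : G 1 = 1.
Proof.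
have E : gamma_kernel 0 1 = (fun t => expR (- t)) :> (R -> R).
  by apply/funext => t; rewrite kernelE subrr powRr0 mul1r.
have i1 := gamma_kernel_integrable 0 (@ltr01 R).
suff : Rintegral mu pos (gamma_kernel 0 1) - Rintegral mu pos (cst 0) = 0 - (- expR (- 0)).
  by rewrite oppr0 expR0 Rintegral_cst // mul0r subr0 add0r opprK.
have dF t : is_derive t 1 (fun s => - expR (- s)) (expR (- t) - cst 0 t).
  by apply: is_derive_eq; rewrite /GRing.scale /=; ring.
apply: (primitive_RintegralB (F := fun s => - expR (- s))) => //.
- by move=> t; exact: kernel_continuous.
- by move=> t _; exact: cvg_cst.
- exact: integrable0.
- by move=> t _; rewrite E; exact: dF.
- have c0 : {for (0 : R), continuous (fun s : R => - expR (- s))}.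
    by apply: derivable_continuous; case: (dF 0).
  exact: (cvg_comp _ _ cvg_inv_nat c0).
- have := @cvg_powexp_y 0; under eq_fun do rewrite powRr0 mul1r.
  by move=> /cvgN; rewrite oppr0; apply.
Qed.

Lemma gamma_moment_ge0 x : 0 <= G x.
Proof. by apply: Rintegral_ge0 => t _; exact: kernel_ge0. Qed.

(** Convexity of the exponential between 0 and L.  It follows from 1 + y <= e^y at
    y = (1 - s) L and y = - s L, weighted by s and 1 - s so that the linear terms
    cancel. *)
Lemma expR_tangent s (L : R) : 0 <= s <= 1 -> expR (s * L) <= 1 - s + s * expR L.
Proof.
move=> /andP[s0 s1].
have h1 := expR_ge1Dx ((1 - s) * L); have h2 := expR_ge1Dx (- (s * L)).
have h : 1 <= (1 - s) * expR (- (s * L)) + s * expR ((1 - s) * L).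
  have : (1 - s) * (1 + - (s * L)) <= (1 - s) * expR (- (s * L)) by rewrite ler_wpM2l ?subr_ge0.
  have : s * (1 + (1 - s) * L) <= s * expR ((1 - s) * L) by rewrite ler_wpM2l.
  nra.
have {h} := ler_wpM2l (expR_ge0 (s * L)) h.
rewrite mulr1 mulrDr mulrCA -expRD subrr expR0 mulr1 mulrCA -expRD.
by have -> : s * L + (1 - s) * L = L by ring.
Qed.

(** The concave function t^s lies below its tangent at t = a; integrating against
    t^(a-1) e^(-t), the linear term disappears because a is the mean of t for this
    weight. *)
Lemma gamma_moment_le_powR a s : 0 < a -> 0 <= s <= 1 -> G (a + s) <= a `^ s * G a.
Proof.
move=> a0 s01; have [s0 s1] := andP s01.
have a1 : 0 < a + 1 by rewrite addr_gt0.
have as0 : 0 < a + s by rewrite ltr_pwDl.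
have i0 := gamma_kernel_integrable 0 a0; have i1 := gamma_kernel_integrable 0 a1.
have is_ := gamma_kernel_integrable 0 as0.
pose c0 := a `^ s * (1 - s); pose c1 := a `^ s * s / a.
have iR : mu.-integrable pos (EFin \o (fun t => c0 * gamma_kernel 0 a t + c1 * gamma_kernel 0 (a + 1) t)).
  by apply: (integrableD _ (integrableZl _ c0 i0) (integrableZl _ c1 i1)); exact: measurable_itv.
have -> : a `^ s * G a =
    Rintegral mu pos (fun t => c0 * gamma_kernel 0 a t + c1 * gamma_kernel 0 (a + 1) t).
  transitivity (c0 * G a + c1 * G (a + 1)).
    rewrite gamma_moment_rec // /c0 /c1; field.
    by rewrite gt_eqF.
  have e0 : Rintegral mu pos (fun t => c0 * gamma_kernel 0 a t) = c0 * G a by rewrite RintegralZl.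
  have e1 : Rintegral mu pos (fun t => c1 * gamma_kernel 0 (a + 1) t) = c1 * G (a + 1).
    by rewrite RintegralZl.
  rewrite RintegralD ?e0 ?e1 //.
    by apply: (integrableZl _ c0 i0); exact: measurable_itv.
  by apply: (integrableZl _ c1 i1); exact: measurable_itv.
apply: le_Rintegral => //.
move=> t; rewrite /= in_itv /= andbT => t0.
have tn0 r : (r == 0) ==> (t != 0) by rewrite (gt_eqF t0) implybT.
rewrite !kernelE.
have -> : a + 1 - 1 = (a - 1) + 1 by ring.
have -> : a + s - 1 = (a - 1) + s by ring.
rewrite (@powRD _ t (a - 1) 1) ?tn0 // (@powRD _ t (a - 1) s) ?tn0 // powRr1 ?(ltW t0) //.
set p := t `^ (a - 1); set e := expR (- t).
have -> : p * t `^ s * e = p * e * t `^ s by ring.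
have -> : c0 * (p * e) + c1 * (p * t * e) = p * e * (c0 + c1 * t) by ring.
rewrite ?expr0 ?mul1r; apply: ler_wpM2l; first by rewrite mulr_ge0 ?powR_ge0 ?expR_ge0.
have h := expR_tangent (ln t - ln a) s01.
rewrite [_ - _]lock mulrC -lock in h.
rewrite !powR_expR_ln //.
have := ler_wpM2l (expR_ge0 (s * ln a)) h.
rewrite -expRD; have -> : s * ln a + (ln t - ln a) * s = s * ln t by ring.
rewrite expRB !lnK ?posrE // => /le_trans; apply.
by rewrite /c0 /c1 powR_expR_ln // le_eqVlt; apply/orP; left; apply/eqP; field; rewrite gt_eqF.
Qed.

Lemma gamma_moment_fact n : G n.+1%:R = n`!%:R.
Proof.
elim: n => [|n IH]; first by rewrite gamma_moment1 fact0.
by rewrite -natr1 gamma_moment_rec // IH -natrM factS.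
Qed.

Lemma gamma_moment_prod x n : 0 < x -> G (x + n%:R) = \prod_(k < n) (x + k%:R) * G x.
Proof.
move=> x0; elim: n => [|n IH]; first by rewrite addr0 big_ord0 mul1r.
have xn : 0 < x + n%:R by rewrite ltr_pwDl.
by rewrite -natr1 addrA (gamma_moment_rec xn) IH big_ord_recr /= mulrCA mulrA.
Qed.

(** The error factor in Gauss' limit for Gamma, for x and 1 - x together. *)
Definition gauss_ratio x n : R := G (x + n%:R) * G (1 - x + n%:R) / (n`!%:R * n.-1`!%:R).

(** Going up from n by x and by 1 - x bounds the product above; going up from
    n + x and n + 1 - x to n + 1 bounds it below. *)
Lemma gauss_ratio_bound x m : 0 < x < 1 ->
  m.+1%:R / m.+2%:R <= gauss_ratio x m.+1 <= 1.
Proof.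
move=> /andP[x0 x1].
have n0 : 0 < m.+1%:R :> R by [].
have y0 : 0 < 1 - x by rewrite subr_gt0.
have y1 : 1 - x <= 1 by rewrite gerBl ltW.
have x01 : 0 <= x <= 1 by rewrite !ltW.
have y01 : 0 <= 1 - x <= 1 by rewrite y1 ltW.
have f0 k : 0 < k`!%:R :> R by rewrite ltr0n fact_gt0.
have D0 : 0 < m.+1`!%:R * m`!%:R :> R by rewrite mulr_gt0.
have up s : 0 <= s <= 1 -> G (s + m.+1%:R) <= m.+1%:R `^ s * m`!%:R.
  by move=> s01; rewrite addrC -gamma_moment_fact gamma_moment_le_powR.
have lo s : 0 < s <= 1 -> m.+1`!%:R <= m.+2%:R `^ (1 - s) * G (s + m.+1%:R).
  move=> /andP[s0 s1]; rewrite -gamma_moment_fact.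
  have -> : m.+2%:R = s + m.+1%:R + (1 - s) :> R by rewrite -natr1; ring.
  have sm : 0 < s + m.+1%:R by rewrite addr_gt0.
  have s01' : 0 <= 1 - s <= 1 by rewrite subr_ge0 s1 gerBl ltW.
  apply: le_trans (gamma_moment_le_powR sm s01') _.
  have sum0 : 0 <= s + m.+1%:R + (1 - s) by rewrite addr_ge0 ?(ltW sm) // subr_ge0.
  rewrite ler_wpM2r ?gamma_moment_ge0 // ge0_ler_powR ?nnegrE ?subr_ge0 ?(ltW sm) //.
  by rewrite lerDl subr_ge0.
rewrite /gauss_ratio /=; apply/andP; split; last first.
  rewrite ler_pdivrMr // mul1r (le_trans (ler_pM (gamma_moment_ge0 _) (gamma_moment_ge0 _) (up _ x01) (up _ y01))) //.
  rewrite mulrACA -powRD ?pnatr_eq0 ?implybT // addrCA subrr addr0 powRr1 //.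
  by rewrite factS natrM mulrA.
have h := ler_pM (ltW (f0 m.+1)) (ltW (f0 m.+1)) (lo x _) (lo (1 - x) _).
rewrite mulrACA -powRD ?pnatr_eq0 ?implybT // in h.
rewrite ler_pdivlMr // mulrAC ler_pdivrMr ?ltr0n //.
have -> : m.+1%:R * (m.+1`!%:R * m`!%:R) = m.+1`!%:R * m.+1`!%:R :> R.
  by rewrite [in RHS]factS natrM; ring.
rewrite [leRHS]mulrC; apply: le_trans (h _ _) _; rewrite ?x0 ?y0 ?(ltW x1) //.
have -> : 1 - x + (1 - (1 - x)) = 1 by ring.
by rewrite powRr1 // mulrC.
Qed.

Lemma gauss_ratio_cvg x : 0 < x < 1 -> gauss_ratio x m.+1 @[m --> \oo] --> (1 : R).
Proof.
move=> x01.
apply: (@squeeze_cvgr _ _ _ _ (fun m => m.+1%:R / m.+2%:R) (cst 1)).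
- by apply: nearW => m; exact: gauss_ratio_bound.
- have -> : (fun m => m.+1%:R / m.+2%:R) = (fun m => 1 - m.+2%:R^-1) :> (nat -> R).
    apply/funext => m; rewrite -[m.+2%:R]natr1.
    by field; rewrite nat1r natr1 pnatr_eq0.
  have := cvgB (cvg_cst (1 : R)) cvg_inv_nat; rewrite subr0; exact.
- exact: cvg_cst.
Qed.

Lemma prod_shift x m :
  \prod_(k < m.+1) (x + k%:R) * \prod_(k < m.+1) (1 - x + k%:R) =
  x * (m.+1%:R - x) * m`!%:R ^+ 2 * \prod_(k < m) (1 - x ^+ 2 / k.+1%:R ^+ 2) :> R.
Proof.
elim: m => [|m IH].
  by rewrite !big_ord_recl !big_ord0 /= fact0; ring.
rewrite big_ord_recr [X in _ * X]big_ord_recr mulrACA IH [in RHS]big_ord_recr /=.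
rewrite factS natrM -[m.+2%:R]natr1; field.
by rewrite nat1r pnatr_eq0.
Qed.

(** An exact form of the reflection formula at each stage m: the partial products
    of Gauss and of Euler cancel, and three factors tending to 1 remain. *)
Lemma gamma_sine_exact x m : 0 < x < 1 ->
  G x * G (1 - x) * sin (pi * x) * (1 - x / m.+1%:R) =
  pi * (gauss_ratio x m.+1 * sine_tail x m).
Proof.
move=> /andP[x0 x1]; have y0 : 0 < 1 - x by rewrite subr_gt0.
rewrite (@sine_product _ _ m) ?gt_eqF // /gauss_ratio !gamma_moment_prod //.
have := prod_shift x m.
set A := \prod_(k < m.+1) (x + _); set B := \prod_(k < m.+1) (1 - x + _).
set P := \prod_(k < m) _ => E.
rewrite (mulrACA A) E /= factS natrM.
move: (sine_tail x m) (G x) (G (1 - x)) P {E} (pi : R) => r g h P p.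
have f0 : m`!%:R != 0 :> R by rewrite pnatr_eq0 -lt0n fact_gt0.
move: (m`!%:R : R) f0 => f f0; field.
by rewrite f0 nat1r pnatr_eq0.
Qed.

Lemma gamma_moment_reflection x : 0 < x < 1 -> G x * G (1 - x) * sin (pi * x) = pi.
Proof.
move=> x01.
have h1 : G x * G (1 - x) * sin (pi * x) * (1 - x / m.+1%:R) @[m --> \oo] -->
    G x * G (1 - x) * sin (pi * x).
  rewrite -[X in _ --> X]mulr1; apply: cvgM; first exact: cvg_cst.
  rewrite -[X in _ --> X]subr0; apply: cvgB; first exact: cvg_cst.
  rewrite -[X in _ --> X](mulr0 x); apply: cvgM; first exact: cvg_cst.
  exact: cvg_harmonic.
have h2 : G x * G (1 - x) * sin (pi * x) * (1 - x / m.+1%:R) @[m --> \oo] --> (pi : R).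
  have -> : (fun m => G x * G (1 - x) * sin (pi * x) * (1 - x / m.+1%:R)) =
      (fun m => pi * (gauss_ratio x m.+1 * sine_tail x m)).
    by apply/funext => m; exact: gamma_sine_exact.
  rewrite -[X in _ --> X]mulr1; apply: cvgM; first exact: cvg_cst.
  rewrite -[X in _ --> X]mulr1; apply: cvgM; first exact: gauss_ratio_cvg.
  exact: sine_tail_cvg.
exact: (cvg_unique _ h1 h2).
Qed.

End Reflection.

Section GammaFunction.
Context {R : realType}.
Implicit Types (x : R) (n : nat).
Local Notation G := (@gamma_moment R 0).

Lemma Gamma_pos x : 0 < x -> Gamma x = G x.
Proof.
move=> x0; rewrite /Gamma euler_integralE.
suff -> : Num.truncn (1 - x) = 0%N by rewrite big_ord0 divr1 addr0.
by apply/truncn0Pn; rewrite -ltNge gtrBl.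
Qed.

Lemma Gamma_rec x : x != 0 -> Gamma (x + 1) = x * Gamma x.
Proof.
move=> x0; case: (ltP 0 x) => [xp|xn].
  by rewrite !Gamma_pos ?addr_gt0 // gamma_moment_rec.
rewrite /Gamma !euler_integralE.
have -> : 1 - (x + 1) = - x by ring.
have -> : Num.truncn (1 - x) = (Num.truncn (- x)).+1.
  have /andP[l u] := truncn_itv (x := - x) ltac:(by rewrite oppr_ge0).
  apply: truncn_def; rewrite -!(natr1 _.+1) -natr1 in u *; apply/andP; split; lra.
set n := Num.truncn (- x).
rewrite big_ord_recl /= addr0 -natr1.
have -> : x + (n%:R + 1) = x + 1 + n%:R by ring.
have -> : \prod_(i < n) (x + (lift ord0 i)%:R) = \prod_(i < n) (x + 1 + i%:R).
  by apply: eq_bigr => i _; rewrite /= /bump /= -nat1r addrA.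
by rewrite invfM mulrCA mulVKf.
Qed.

(** The left-hand side is invariant under x -> x + 1, which reduces the formula to
    0 < x < 1. *)
Lemma Gamma_reflection x : (forall k : int, x != k%:~R) ->
  Gamma x * Gamma (1 - x) * sin (pi * x) = pi.
Proof.
pose Q x := Gamma x * Gamma (1 - x) * sin (pi * x).
have base y : 0 < y < 1 -> Q y = pi.
  move=> y01; have /andP[y0 y1] := y01.
  by rewrite /Q !Gamma_pos ?subr_gt0 // gamma_moment_reflection.
have step y : y != 0 -> Q (y + 1) = Q y.
  move=> y0; rewrite /Q Gamma_rec // mulrDr mulr1 sinDpi.
  have -> : 1 - (y + 1) = - y by ring.
  have -> : 1 - y = - y + 1 by ring.
  by rewrite Gamma_rec ?oppr_eq0 //; ring.
move=> xk; rewrite -/(Q x).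
have shift n y : (forall k : int, y != k%:~R) -> Q (y + n%:R) = Q y.
  move=> yk; elim: n => [|n IH]; first by rewrite addr0.
  rewrite -natr1 addrA step // addr_eq0.
  have -> : - n%:R = (- n%:Z)%:~R :> R by rewrite mulrNz.
  exact: yk.
pose k := Num.floor x; pose y := x - k%:~R.
have yk (j : int) : y != j%:~R by rewrite subr_eq -intrD; exact: xk.
have y01 : 0 < y < 1.
  have /andP[l u] := floor_itv x.
  rewrite lt_neqAle eq_sym (yk 0) /= subr_ge0 l /=.
  by rewrite ltrBlDr addrC; rewrite intrD in u.
have xE : x = y + k%:~R by rewrite /y subrK.
case: (intP k) xE => [|n|n] xE.
- by rewrite xE addr0 base.
- by rewrite xE shift // base.
- by rewrite -(base _ y01) -(shift n.+1 x xk) xE mulrNz subrK.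
Qed.

End GammaFunction.

(** * Higher derivatives of the Gamma function and of the cosecant *)

Section Towers.
Context {R : realType}.
Implicit Types (U : set R) (f g : R -> R) (D E : nat -> R -> R) (x : R) (n : nat).

(** D is the sequence of derivatives of f on U.  Working with explicit sequences
    keeps differentiability and the value of the derivatives together. *)
Definition derivatives U f D :=
  (forall x, U x -> D 0%N x = f x) /\
  (forall n x, U x -> is_derive x 1 (D n) (D n.+1 x)).

Lemma derivatives_derive1n U f D : open U -> derivatives U f D ->
  forall n x, U x -> derive1n n f x = D n x.
Proof.
move=> oU [D0 DS]; elim=> [|n IH] x Ux; first by rewrite D0.
rewrite /derive1n iterS derive1E.
rewrite (@near_eq_derive _ _ _ _ (D n)); first by have := DS n x Ux => -[].
by near=> y; apply: IH; near: y; exact: open_nbhs_nbhs.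
Unshelve. end_near. Qed.

Lemma derivatives_unique U f D E : open U -> derivatives U f D -> derivatives U f E ->
  forall n x, U x -> D n x = E n x.
Proof.
move=> oU hD hE n x Ux.
by rewrite -(derivatives_derive1n oU hD) // (derivatives_derive1n oU hE).
Qed.

Lemma eq_derivatives U f g D : (forall x, U x -> f x = g x) ->
  derivatives U f D -> derivatives U g D.
Proof. by move=> fg [D0 DS]; split => // x Ux; rewrite D0 // fg. Qed.

Definition leibniz D E n x := \sum_(k < n.+1) 'C(n, k)%:R * (D k x * E (n - k)%N x).

(** Leibniz' rule, by Pascal's identity. *)
Lemma derivatives_mul U f g D E : derivatives U f D -> derivatives U g E ->
  derivatives U (fun x => f x * g x) (leibniz D E).
Proof.
move=> [D0 DS] [E0 ES]; split => [x Ux|n x Ux].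
  by rewrite /leibniz big_ord1 bin0 mul1r D0 // E0.
have h (k : 'I_n.+1) : is_derive x 1 (fun y => 'C(n, k)%:R * (D k y * E (n - k)%N y))
    ('C(n, k)%:R * (D k.+1 x * E (n - k)%N x + D k x * E (n - k).+1 x)).
  have h1 := DS k x Ux; have h2 := ES (n - k)%N x Ux.
  by apply: is_derive_eq; rewrite /GRing.scale /=; ring.
have -> : leibniz D E n = \sum_(k < n.+1) (fun y => 'C(n, k)%:R * (D k y * E (n - k)%N y)).
  by apply/funext => y; rewrite fct_sumE.
apply: is_derive_eq; rewrite /leibniz.
under eq_bigr do rewrite mulrDr.
rewrite big_split /= big_ord_recr /= [X in _ + X]big_ord_recl /=.
rewrite [RHS]big_ord_recl [X in _ = _ + X]big_ord_recr /=.
rewrite !subn0 binn bin0 /bump /= !add1n subnn binn.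
have -> : \sum_(i < n) 'C(n.+1, i.+1)%:R * (D i.+1 x * E (n.+1 - i.+1)%N x) =
    \sum_(i < n) 'C(n, i)%:R * (D i.+1 x * E (n - i)%N x) +
    \sum_(i < n) 'C(n, i.+1)%:R * (D i.+1 x * E (n - i.+1).+1 x).
  rewrite -big_split /=; apply: eq_bigr => i _.
  by rewrite binS natrD subSS -subSn ?ltn_ord // subSS; ring.
have -> : \sum_(i < n) 'C(n, 1 + i)%:R * (D (1 + i)%N x * E (n - (1 + i)).+1 x) =
    \sum_(i < n) 'C(n, i.+1)%:R * (D i.+1 x * E (n - i.+1).+1 x) by [].
rewrite subnn bin0; ring.
Qed.

Lemma derivatives_affine U f D (a c : R) : derivatives U f D ->
  derivatives (fun x => U (a * x + c)) (fun x => f (a * x + c))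
    (fun n x => a ^+ n * D n (a * x + c)).
Proof.
move=> [D0 DS]; split => [x Ux|n x Ux]; first by rewrite mul1r D0.
have h0 : is_derive x 1 (fun y => a * y + c) a.
  by apply: is_derive_eq; rewrite /GRing.scale /=; ring.
have h1 := @is_derive1_comp _ (D n) (fun y => a * y + c) x _ _ (DS n _ Ux) h0.
have h2 : is_derive x 1 (fun y => D n (a * y + c)) (a * D n.+1 (a * x + c)).
  by rewrite mulrC; exact: h1.
by apply: is_derive_eq; rewrite /GRing.scale /= exprSr; ring.
Qed.

Lemma derivatives_inv : derivatives (fun x => x != 0) (fun x => x^-1)
  (fun n x => (-1) ^+ n * n`!%:R * x^-1 ^+ n.+1).
Proof.
split => [x x0|n x x0]; first by rewrite fact0 expr0 expr1; ring.
have h0 : is_derive x 1 (fun y : R => y^-1) (- x ^- 2).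
  have hid : is_derive x 1 (id : R -> R) 1 by exact: is_derive_id.
  by have := is_deriveV x0 hid; rewrite /GRing.scale /= mulr1.
have h1 := is_derive_pow n.+1 h0.
apply: is_derive_eq; rewrite /GRing.scale /= factS natrM -(exprVn x 2) !exprS.
by ring.
Qed.

Lemma derivatives_sub U V f D : V `<=` U -> derivatives U f D -> derivatives V f D.
Proof. by move=> VU [D0 DS]; split=> [x /VU|n x /VU]; [exact: D0|exact: DS]. Qed.

Lemma derivatives_local U f : open U ->
  (forall x, U x -> exists V D, [/\ open V, V x & derivatives V f D]) ->
  derivatives U f (fun n => derive1n n f).
Proof.
move=> oU h; split=> [x _ //|n x Ux].
have [V [D [oV Vx hD]]] := h x Ux.
rewrite (derivatives_derive1n oV hD) //.
apply: (near_eq_is_derive (f := D n)); last exact: (hD.2 n x Vx).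
near=> y; rewrite (derivatives_derive1n oV hD) //.
by near: y; exact: open_nbhs_nbhs.
Unshelve. end_near. Qed.

(** The reals that are not integers, in a form that is visibly open. *)
Definition nonint : set R := [set x | sin (pi * x) != 0].

Lemma open_nonint : open nonint.
Proof.
have c : continuous (fun x : R => sin (pi * x)).
  by move=> x; apply: derivable_continuous; apply: ex_derive.
have -> : nonint = (fun x : R => sin (pi * x)) @^-1` [set y | y != 0] by [].
by apply: open_comp => //; exact: open_neq.
Qed.

Lemma nonint_neq x : nonint x -> forall k : int, x != k%:~R.
Proof.
move=> Ux k; apply: contraNneq Ux => ->.
have h n : sin (pi * n%:R) = 0 :> R.
  elim: n => [|n IH]; first by rewrite mulr0 sin0.
  by rewrite -natr1 mulrDr mulr1 sinDpi IH oppr0.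
case: (intP k) => [|n|n]; first by rewrite mulr0 sin0.
  by apply/eqP; exact: h.
by rewrite mulrNz mulrN sinN oppr_eq0; apply/eqP; exact: h.
Qed.

(** By the reflection formula: the product that contains the sine is nonzero. *)
Lemma neq_nonint x : (forall k : int, x != k%:~R) -> nonint x.
Proof.
move=> /Gamma_reflection E; apply/eqP => s0; move: E.
by rewrite s0 mulr0 => /eqP; rewrite lt_eqF // pi_gt0.
Qed.

Lemma nonint_onem x : nonint x -> nonint (1 - x).
Proof.
move=> Ux; apply: neq_nonint => k; have := nonint_neq Ux (1 - k).
by apply: contra => /eqP e; apply/eqP; rewrite intrB -e; ring.
Qed.

Lemma nonintD1 x : nonint x -> nonint (x + 1).
Proof. by rewrite /nonint /= mulrDr mulr1 sinDpi oppr_eq0. Qed.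

(** By induction on N from Gamma(x) = Gamma(x + 1) / x: smoothness spreads to the
    left one unit at a time. *)
Lemma Gamma_derivatives_gt N : exists D,
  derivatives (nonint `&` [set x | - N%:R < x]) (@Gamma R) D.
Proof.
elim: N => [|N [D hD]].
  exists (@gamma_moment R).
  split => [x [_]|n x [_]] /=; rewrite oppr0 => x0; first by rewrite Gamma_pos.
  exact: is_derive_gamma_moment.
have := derivatives_mul (derivatives_sub _ (derivatives_affine 1 1 hD))
   (derivatives_sub _ derivatives_inv).
move=> /(_ (nonint `&` [set x | - N.+1%:R < x])) h.
eexists; apply: eq_derivatives (h _ _).
- move=> x [Ux _]; have x0 := nonint_neq Ux 0.
  by rewrite mul1r Gamma_rec // mulrC mulKf.
- move=> x [Ux] /= xN; rewrite mul1r; split; first exact: nonintD1.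
  by rewrite -ltrBlDr -opprD natr1.
- by move=> x [Ux _]; exact: (nonint_neq Ux 0).
Qed.

Lemma Gamma_derivatives : derivatives nonint (@Gamma R) (fun n => derive1n n (@Gamma R)).
Proof.
apply: derivatives_local; first exact: open_nonint.
move=> x Ux; pose N := (Num.truncn (- x)).+1.
have [D hD] := Gamma_derivatives_gt N.
exists (nonint `&` [set x | - N%:R < x]), D; split => //.
  by apply: openI; [exact: open_nonint | exact: open_gt].
by split => //=; rewrite ltrNl truncnS_gt.
Qed.

(** The numerators of the derivatives of the cosecant, as polynomials in the
    cosine. *)
Fixpoint cscpoly n : {poly rat} :=
  if n is m.+1 then (m.+1%:R *: 'X) * cscpoly m + (1 - 'X^2) * (cscpoly m)^`() else 1.

Let cp n : {poly R} := map_poly ratr (cscpoly n).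

Lemma csc_derivatives : derivatives nonint (fun x => pi / sin (pi * x))
  (fun n x => pi ^+ n.+1 * ((-1) ^+ n * (cp n).[cos (pi * x)] * (sin (pi * x))^-1 ^+ n.+1)).
Proof.
split => [x Ux|n x Ux].
  by rewrite /cp /= rmorph1 hornerC !expr1 expr0 !mul1r.
have hs : is_derive x 1 (fun y : R => sin (pi * y)) (pi * cos (pi * x)).
  by apply: is_derive_eq; rewrite /GRing.scale /=; ring.
have hc : is_derive x 1 (fun y : R => cos (pi * y)) (- pi * sin (pi * x)).
  by apply: is_derive_eq; rewrite /GRing.scale /=; ring.
have hV : is_derive x 1 (fun y : R => (sin (pi * y))^-1) (- sin (pi * x) ^- 2 * (pi * cos (pi * x))).
  exact: (is_deriveV Ux hs).
have hp : is_derive x 1 (fun y : R => (cp n).[cos (pi * y)])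
    ((cp n)^`().[cos (pi * x)] * (- pi * sin (pi * x))).
  exact: (@is_derive1_comp _ (horner (cp n)) (fun y => cos (pi * y)) x _ _ (is_derive_poly _ _) hc).
have hX := is_derive_pow n.+1 hV.
apply: is_derive_eq; rewrite /GRing.scale /=.
have -> : (cp n.+1).[cos (pi * x)] = n.+1%:R * cos (pi * x) * (cp n).[cos (pi * x)] +
    sin (pi * x) ^+ 2 * (cp n)^`().[cos (pi * x)].
  rewrite sin2cos2 /cp /= rmorphD !rmorphM /= map_polyZ map_polyX rmorphB rmorph1 /= map_polyXn.
  by rewrite deriv_map ratr_nat hornerD !hornerM hornerZ hornerX hornerD hornerN hornerC hornerXn.
rewrite -(exprVn _ 2).
have e : sin (pi * x) ^+ 2 * (sin (pi * x))^-1 ^+ n.+2 = sin (pi * x) * (sin (pi * x))^-1 ^+ n.+1.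
  by rewrite [_^-1 ^+ n.+2]exprS expr2 -mulrA mulVKf.
move: e; set v := (sin (pi * x))^-1; set w := sin (pi * x); set c := cos (pi * x).
move: (cp n).[c] ((cp n)^`().[c]) => p p' e.
transitivity (pi ^+ n.+2 * ((-1) ^+ n.+1 * (n.+1%:R * c * p) * v ^+ n.+2 +
   (-1) ^+ n.+1 * p' * (w ^+ 2 * v ^+ n.+2))); last by ring.
rewrite e !exprS; ring.
Qed.

(** In degree j + 1 the recurrence multiplies the coefficient of degree j by
    n + 1 - j, which is nonnegative up to the degree n. *)
Lemma cscpoly_coef n j : (0 <= (cscpoly n)`_j) /\ ((n < j)%N -> (cscpoly n)`_j = 0).
Proof.
elim: n j => [|n IH] j.
  by rewrite /= coef1; split; [rewrite ler0n | case: j].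
have E i : (cscpoly n.+1)`_i.+1 = (n.+1%:R - i%:R) * (cscpoly n)`_i + (cscpoly n)`_i.+2 *+ i.+2.
  rewrite /= coefD -scalerAl coefZ coefXM /= mulrBl mul1r coefB coefXnM !coef_deriv.
  case: i => [|i] /=; first by rewrite subr0 subr0; ring.
  by rewrite !subSS subn0; ring.
have E0 : (cscpoly n.+1)`_0 = (cscpoly n)`_1.
  by rewrite /= coefD -scalerAl coefZ coefXM /= mulr0 add0r mulrBl mul1r coefB coefXnM coef_deriv subr0.
case: j => [|j]; first by rewrite E0; split => //; case: (IH 1).
rewrite E; have [hj vj] := IH j; have [hj2 vj2] := IH j.+2; split.
  have [nj|jn] := ltnP n j; first by rewrite vj // mulr0 add0r mulrn_wge0.
  by rewrite addr_ge0 ?mulrn_wge0 // mulr_ge0 // subr_ge0 ler_nat ltnW.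
have nj2 : (n < j)%N -> (n < j.+2)%N by lia.
by rewrite ltnS => nj; rewrite vj // vj2 ?nj2 // mulr0 mul0rn addr0.
Qed.

Lemma cscpoly1 n : (cscpoly n).[1] = n`!%:R.
Proof.
elim: n => [|n IH]; first by rewrite hornerC.
rewrite /= hornerD !hornerM hornerZ hornerX hornerD hornerN hornerC hornerXn IH.
by rewrite expr1n subrr mul0r addr0 mulr1 factS natrM.
Qed.

Lemma cscpoly_parity n x : (cp n).[- x] = (-1) ^+ n * (cp n).[x].
Proof.
have rec m y : (cp m.+1).[y] = m.+1%:R * y * (cp m).[y] + (1 - y ^+ 2) * (cp m)^`().[y].
  rewrite /cp /= rmorphD !rmorphM /= map_polyZ map_polyX rmorphB rmorph1 /= map_polyXn.
  by rewrite deriv_map ratr_nat hornerD !hornerM hornerZ hornerX hornerD hornerN hornerC hornerXn.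
have [] : (forall y, (cp n).[- y] = (-1) ^+ n * (cp n).[y]) /\ True; last by [].
elim: n => [|n [IH _]]; split=> // y.
  by rewrite /cp /= rmorph1 !hornerC mul1r.
have D : (cp n)^`().[- y] = - (-1) ^+ n * (cp n)^`().[y].
  have h0 : is_derive y 1 (fun y : R => - y) (- 1) by apply: is_derive_eq.
  have h1 := @is_derive1_comp _ (horner (cp n)) (fun y => - y) y _ _ (is_derive_poly _ _) h0.
  have h2 : is_derive y 1 (fun y => (-1) ^+ n * (cp n).[y]) ((-1) ^+ n * (cp n)^`().[y]).
    have h := is_derive_poly (cp n) y.
    by apply: is_derive_eq; rewrite /GRing.scale /=; ring.
  have : (horner (cp n) \o (fun y => - y)) = (fun y => (-1) ^+ n * (cp n).[y]).
    by apply/funext => z; exact: IH.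
  move=> fE; rewrite fE in h1.
  have [_ e1] := h1; have [_ e2] := h2; rewrite e2 in e1.
  by rewrite mulNr e1; ring.
rewrite !rec IH D sqrrN [(-1) ^+ n.+1]exprS; ring.
Qed.

(** With nonnegative coefficients, not all zero since the value at 1 is n!, the
    polynomial is positive at x > 0; parity gives x < 0. *)
Lemma cscpoly_neq0 n x : x != 0 -> (cp n).[x] != 0.
Proof.
have pos y : 0 < y -> 0 < (cp n).[y].
  move=> y0.
  have c0 j : 0 <= (cp n)`_j by rewrite coef_map /= ler0q; case: (cscpoly_coef n j).
  have p0 : cp n != 0.
    rewrite map_poly_eq0; apply/eqP => e; have := cscpoly1 n.
    by rewrite e horner0 => /esym /eqP; rewrite pnatr_eq0 -leqn0 leqNgt fact_gt0.
  have sz : (0 < size (cp n))%N by rewrite size_poly_gt0.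
  have szl : ((size (cp n)).-1 < size (cp n))%N by rewrite prednK.
  rewrite horner_coef (bigD1 (Ordinal szl)) //= ltr_pwDl //.
    rewrite mulr_gt0 ?exprn_gt0 // lt0r c0 andbT.
    by move: p0; rewrite -lead_coef_eq0 /lead_coef.
  by apply: sumr_ge0 => i _; rewrite mulr_ge0 ?exprn_ge0 // ltW.
case: (ltgtP x 0) => [x0 _|x0 _|//].
  have := pos (- x); rewrite oppr_gt0 cscpoly_parity => /(_ x0) h.
  by apply: contraTneq h => ->; rewrite mulr0 ltxx.
by rewrite gt_eqF // pos.
Qed.

End Towers.

(** * Linear algebra over the real algebraic numbers *)

Section Span.
Variables (F K : fieldType) (f : {rmorphism F -> K}).

(** More vectors than coordinates: the matrix has a nonzero left kernel. *)
Lemma linear_dependence M (L : nat -> 'I_M -> F) :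
  exists2 u : 'rV[F]_M.+1, u != 0 & forall v, \sum_i u 0 i * L i v = 0.
Proof.
pose A : 'M[F]_(M.+1, M) := \matrix_(i, v) L i v.
have : kermx A != 0.
  by rewrite -mxrank_eq0 mxrank_ker subn_eq0 -ltnNge ltnS rank_leq_col.
move=> /rowV0Pn[u /sub_kermxP uA u0]; exists u => // v.
have := congr1 (fun B : 'rV_M => B 0 v) uA; rewrite !mxE => e; rewrite -[RHS]e.
by apply: eq_bigr => i _; rewrite mxE.
Qed.

Definition lin_span (ws : seq K) (x : K) :=
  exists l : 'I_(size ws) -> F, x = \sum_v f (l v) * ws`_v.

Lemma lin_span0 ws : lin_span ws 0.
Proof. by exists (fun=> 0); rewrite big1 // => v _; rewrite rmorph0 mul0r. Qed.

Lemma lin_spanD ws x y : lin_span ws x -> lin_span ws y -> lin_span ws (x + y).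
Proof.
move=> [l ->] [m ->]; exists (fun v => l v + m v); rewrite -big_split /=.
by apply: eq_bigr => v _; rewrite rmorphD mulrDl.
Qed.

Lemma lin_spanZ ws a x : lin_span ws x -> lin_span ws (f a * x).
Proof.
move=> [l ->]; exists (fun v => a * l v); rewrite mulr_sumr.
by apply: eq_bigr => v _; rewrite rmorphM mulrA.
Qed.

Lemma lin_span_mem ws x : x \in ws -> lin_span ws x.
Proof.
move=> /(nthP 0)[i hi <-]; exists (fun v => (v == Ordinal hi)%:R).
rewrite (bigD1 (Ordinal hi)) //= eqxx rmorph1 mul1r big1 ?addr0 // => v /negbTE ->.
by rewrite rmorph0 mul0r.
Qed.

(** A linear dependence over F between enough powers of x is a nonzero polynomial
    over F that vanishes at x. *)
Lemma algebraic_of_span ws x N : (forall n, (N <= n)%N -> lin_span ws (x ^+ n)) ->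
  algebraicOver f x.
Proof.
move=> h.
have /choice[L hL] : forall n, exists l : 'I_(size ws) -> F,
    x ^+ (n + N) = \sum_v f (l v) * ws`_v by move=> n; apply: h; exact: leq_addl.
have [u u0 hu] := linear_dependence L.
pose p := \sum_i u 0 i *: 'X^(i + N) : {poly F}.
exists p.
  apply: contraNneq u0 => e; apply/eqP/rowP => j; rewrite mxE.
  have := congr1 (fun q : {poly F} => q`_(j + N)) e.
  rewrite coef0 coef_sum (bigD1 j) //= coefZ coefXn eqxx mulr1 big1 ?addr0 //.
  move=> i /negbTE ij; rewrite coefZ coefXn eqn_add2r eq_sym -val_eqE /= in ij *.
  by rewrite ij mulr0.
rewrite /root rmorph_sum horner_sum; apply/eqP.
transitivity (\sum_i f (u 0 i) * \sum_v f (L i v) * ws`_v).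
  by apply: eq_bigr => i _; rewrite /= map_polyZ /= map_polyXn hornerZ hornerXn hL.
under eq_bigr do rewrite mulr_sumr.
rewrite exchange_big /=; apply: big1 => v _.
under eq_bigr do rewrite mulrA -rmorphM.
by rewrite -mulr_suml -rmorph_sum hu rmorph0 mul0r.
Qed.

End Span.

Section AlgebraicNumbers.
Variable R : realType.

Definition algebraic_real : {pred R} := [pred x | `[< algebraicOver (ratr : rat -> R) x >]].

Lemma algebraic_realP (x : R) : reflect (algebraicOver (ratr : rat -> R) x) (x \in algebraic_real).
Proof. exact: asboolP. Qed.

Lemma algebraic_real_divring : divring_closed algebraic_real.
Proof.
split; first by apply/algebraic_realP; exact: algebraic1.
  by move=> x y /algebraic_realP hx /algebraic_realP hy; apply/algebraic_realP; exact: algebraic_sub.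
by move=> x y /algebraic_realP hx /algebraic_realP hy; apply/algebraic_realP; exact: algebraic_div.
Qed.

HB.instance Definition _ := GRing.isDivringClosed.Build R algebraic_real algebraic_real_divring.

(** The real algebraic numbers as a field of their own, so that matrices and
    kernels over them are available. *)
Record algnum := AlgNum { algval : R; _ : algval \in algebraic_real }.

HB.instance Definition _ := [isSub for algval].
HB.instance Definition _ := [Choice of algnum by <:].
HB.instance Definition _ := [SubChoice_isSubComUnitRing of algnum by <:].
HB.instance Definition _ := [SubComUnitRing_isSubIntegralDomain of algnum by <:].
HB.instance Definition _ := [SubIntegralDomain_isSubField of algnum by <:].

Let toR : {rmorphism algnum -> R} := val.

Lemma algnum_mem (a : algnum) : toR a \in algebraic_real.
Proof. exact: valP. Qed.

Lemma algebraicOver_algnum (x : R) : algebraicOver toR x -> x \in algebraic_real.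
Proof.
move=> [p p0 px]; apply/algebraic_realP/integral_algebraic.
apply: (integral_root (p := map_poly toR p)) => //; first by rewrite map_poly_eq0.
move=> y /(nthP 0)[i _ <-]; apply/integral_algebraic/algebraic_realP.
by rewrite coef_map; exact: algnum_mem.
Qed.

Lemma algebraic_ratr (r : rat) : (ratr r : R) \in algebraic_real.
Proof. by apply/algebraic_realP; exact: algebraic_id. Qed.

(** Twice the cosine is the sum of e^(i t) and e^(-i t), which are roots of unity
    when t is a rational multiple of pi. *)
Lemma cos_rational (q : rat) : cos (pi * ratr q) \in algebraic_real.
Proof.
apply/algebraic_realP/algebraicOver_real_complex.
pose t : R := pi * ratr q.
pose z (s : R) : R[i] := cexp (Complex 0 s).
have zD s s' : z (s + s') = z s * z s'.
  by rewrite /z -cexpD; congr cexp; apply/eqP; rewrite eq_complex /= addr0 !eqxx.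
have zX s n : z (s *+ n) = z s ^+ n.
  by elim: n => [|n IH]; rewrite ?mulr0n ?expr0 ?mulrS ?exprS ?zD ?IH // /z cexp0.
have zN s : z (- s) * z s = 1 by rewrite -zD addNr /z cexp0.
have z2pi (k : int) : z (pi * 2 * k%:~R) = 1.
  have h n : z (pi * 2 * n%:R) = 1.
    by rewrite mulr_natr zX mulr_natr zX /z cexp_pi sqrrN expr1n expr1n.
  case: (intP k) => [|n|n]; [exact: (h 0%N) | exact: h|].
  by rewrite -[LHS]mulr1 -(h n.+1) mulrNz mulrN zN.
have zalg s : z s ^+ (2 * `|denq q|)%N = 1 -> algebraicOver (ratr : rat -> R[i]) (z s).
  move=> e; exists ('X^(2 * `|denq q|)%N - 1).
    by rewrite -size_poly_gt0 size_XnsubC // muln_gt0 /= absz_gt0 denq_neq0.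
  by rewrite /root rmorphB rmorph1 /= map_polyXn !hornerE e subrr.
have tE : t *+ (2 * `|denq q|)%N = pi * 2 * (numq q)%:~R.
  have dE : (`|denq q|%N%:R : R) = (denq q)%:~R by rewrite -[in RHS]absz_denq.
  have qE : ratr q * (denq q)%:~R = (numq q)%:~R :> R.
    by rewrite -!(ratr_int R) -rmorphM -numqE.
  by rewrite -[LHS]mulr_natl natrM dE -qE /t; ring.
have zt : algebraicOver (ratr : rat -> R[i]) (z t) by apply: zalg; rewrite -zX tE z2pi.
have zNt : algebraicOver (ratr : rat -> R[i]) (z (- t)).
  by apply: zalg; rewrite -zX mulNrn tE -mulrN -mulrNz z2pi.
have -> : (cos t)%:C%C = (z t + z (- t)) * ratr (2^-1).
  rewrite fmorphV /= ratr_nat; apply: (@mulIf _ 2); first by rewrite pnatr_eq0.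
  rewrite mulfVK ?pnatr_eq0 // mulr_natr /z /cexp /= expR0 cosN sinN.
  by apply/eqP; rewrite mulr2n eq_complex /=; apply/andP; split; apply/eqP; ring.
by apply: algebraic_mul; [exact: algebraic_add | exact: algebraic_id].
Qed.

Lemma sin_rational (q : rat) : sin (pi * ratr q) \in algebraic_real.
Proof.
have := cos_rational (q - 2^-1).
rewrite rmorphB /= fmorphV /= ratr_nat mulrBr.
by rewrite cosBpihalf.
Qed.

End AlgebraicNumbers.

(** * The theorem *)

Lemma finite_nat_bound (A : set nat) : finite_set A -> exists N, forall n, A n -> (n <= N)%N.
Proof.
move=> /finite_seqP[s ->]; exists (\max_(i <- s) i) => n /= ns.
exact: leq_bigmax_seq.
Qed.

Theorem theorem3 (R : realType) (q : rat)
    (hq : ~ exists k : int, q = k%:~R / 2) :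
  infinite_set [set n : nat | (1 <= n)%N /\
    transcendental (derive1n n (@Gamma R) (ratr q))] \/
  infinite_set [set n : nat | (1 <= n)%N /\
    transcendental (derive1n n (@Gamma R) (1 - ratr q))].
Proof.
apply: contrapT => /not_orP[/contrapT/finite_nat_bound[N1 h1] /contrapT/finite_nat_bound[N2 h2]].
pose N := (N1 + N2).+1; pose x : R := ratr q.
pose a n : R := derive1n n (@Gamma R) x; pose b n : R := derive1n n (@Gamma R) (1 - x).
have alga n : (N <= n)%N -> a n \in @algebraic_real R.
  move=> Nn; apply/algebraic_realP; apply: contrapT => tr.
  have : (n <= N1)%N by apply: h1; split => //; rewrite /N in Nn; lia.
  by rewrite /N in Nn; lia.
have algb n : (N <= n)%N -> b n \in @algebraic_real R.
  move=> Nn; apply/algebraic_realP; apply: contrapT => tr.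
  have : (n <= N2)%N by apply: h2; split => //; rewrite /N in Nn; lia.
  by rewrite /N in Nn; lia.
have qk (k : int) : q != k%:~R / 2 by apply/eqP => e; apply: hq; exists k.
have Ux : nonint x.
  apply: neq_nonint => k; have := qk (k * 2); rewrite intrM mulfK //.
  by rewrite /x -(ratr_int R k) (inj_eq (fmorph_inj _)).
(* q + 1/2 is not an integer either, so sin(pi q + pi/2) is nonzero *)
have cos0 : cos (pi * x) != 0.
  have : nonint (x + 2^-1).
    apply: neq_nonint => k; have := qk (k * 2 - 1).
    apply: contra => /eqP e; apply/eqP; apply: (fmorph_inj (ratr : {rmorphism rat -> R})).
    have xE : x = k%:~R - 2^-1 by rewrite -e addrK.
    by rewrite -[LHS]/x xE fmorph_div /= ratr_nat ratr_int intrB intrM; field.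
  by rewrite /nonint /= mulrDr -cosBpihalf addrK.
have leib n : leibniz (fun n => derive1n n (@Gamma R))
    (fun n y => (-1) ^+ n * derive1n n (@Gamma R) (-1 * y + 1)) n x =
    pi ^+ n.+1 * ((-1) ^+ n * (map_poly ratr (cscpoly n)).[cos (pi * x)] * (sin (pi * x))^-1 ^+ n.+1).
  have hG := @Gamma_derivatives R.
  have hL : derivatives (@nonint R) (fun y => pi / sin (pi * y))
      (leibniz (fun n => derive1n n (@Gamma R))
        (fun n y => (-1) ^+ n * derive1n n (@Gamma R) (-1 * y + 1))).
    have h := derivatives_mul hG (derivatives_sub _ (derivatives_affine (-1) 1 hG)).
    apply: eq_derivatives (h _) => y Uy.
      have s0 : sin (pi * y) != 0 by [].
      apply: (mulIf s0); rewrite divfK // mulN1r addrC.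
      exact: Gamma_reflection (nonint_neq Uy).
    by rewrite mulN1r addrC; exact: nonint_onem.
  exact: (derivatives_unique (@open_nonint R) hL (@csc_derivatives R) n Ux).
pose toR : {rmorphism algnum R -> R} := val.
pose ws : seq R := 1 :: mkseq a N ++ mkseq b N.
have spanZ c y : c \in @algebraic_real R -> lin_span toR ws y -> lin_span toR ws (c * y).
  by move=> hc; exact: (lin_spanZ (f := toR) (AlgNum hc)).
have span_alg c : c \in @algebraic_real R -> lin_span toR ws c.
  by move=> hc; rewrite -[c]mulr1; apply: spanZ hc _; apply: lin_span_mem; rewrite mem_head.
have mem_mk (u : nat -> R) k : (k < N)%N -> u k \in mkseq u N.
  by move=> kN; apply: map_f; rewrite mem_iota.
have span_a k : lin_span toR ws (a k).
  have [kN|Nk] := ltnP k N; last exact: span_alg (alga k Nk).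
  by apply: lin_span_mem; rewrite inE mem_cat mem_mk ?orbT.
have span_b k : lin_span toR ws (b k).
  have [kN|Nk] := ltnP k N; last exact: span_alg (algb k Nk).
  by apply: lin_span_mem; rewrite inE mem_cat (mem_mk b) ?orbT.
(* one of the two indices is at least N *)
have span_ab k m : (2 * N <= k + m)%N -> lin_span toR ws (a k * b m).
  move=> km; have [kN|Nk] := ltnP k N; last exact: spanZ (alga k Nk) (span_b m).
  by rewrite mulrC; apply: spanZ (span_a k); apply: algb; lia.
have span_leib n : (2 * N <= n)%N -> lin_span toR ws
    (leibniz (fun n => derive1n n (@Gamma R))
      (fun n y => (-1) ^+ n * derive1n n (@Gamma R) (-1 * y + 1)) n x).
  move=> Nn; apply: (big_ind (lin_span toR ws)); first exact: lin_span0.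
    by move=> ? ?; exact: lin_spanD.
  move=> k _; rewrite mulN1r addrC -/(a k) -/(b (n - k)%N).
  rewrite (_ : 'C(n, k)%:R * _ = ('C(n, k)%:R * (-1) ^+ (n - k)) * (a k * b (n - k)%N)); last by ring.
  apply: spanZ; first by rewrite rpredM ?rpredX ?rpredN ?rpred1 ?rpred_nat.
  by apply: span_ab; rewrite subnKC // -ltnS.
pose c n : R := (-1) ^+ n * (map_poly ratr (cscpoly n)).[cos (pi * x)] * (sin (pi * x))^-1 ^+ n.+1.
have algc n : c n \in @algebraic_real R.
  rewrite !rpredM ?rpredX ?rpredN ?rpred1 ?rpredV ?sin_rational //.
  rewrite rpred_horner ?cos_rational //.
  by apply/polyOverP => i; rewrite coef_map; exact: algebraic_ratr.
have c0 n : c n != 0.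
  by rewrite !mulf_neq0 ?expf_neq0 ?invr_neq0 ?oppr_eq0 ?oner_eq0 ?cscpoly_neq0.
have : (pi : R) \in @algebraic_real R.
  apply/algebraicOver_algnum/(algebraic_of_span (ws := ws) (N := (2 * N).+1)).
  case=> // n Nn; have := span_leib n Nn; rewrite leib -/(c n) => h.
  rewrite -(mulKf (c0 n) (pi ^+ n.+1)) [c n * _]mulrC.
  by apply: spanZ h; rewrite rpredV.
by move=> /algebraic_realP; exact: pi_transcendental.
Qed.
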